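(* Let $f,g\in\mathcal{SR}$, let $I\in\mathbb S$, let $J\in\mathbb S$ be perpendicular to $I$, and let $F_f,G_f:\mathbb C_I\to\mathbb C_I$ be two holomorphic functions such that $f_I=F_f+G_fJ$. Assume in addition that $G_f$ is not identically zero on $\mathbb C_I$. Then the pointwise product $f\cdot g$ is S-polyregular if and only if $g$ is a right quaternionic polynomial function in $q$.
   Context: $\mathbb H$ is the algebra of quaternions, $\mathbb S=\{I\in\mathbb H: I^2=-1\}$, and for $I\in\mathbb S$, $\mathbb C_I=\mathbb R+\mathbb R I$. For $f:\mathbb H\to\mathbb H$, $f_I=f|_{\mathbb C_I}$, regarded as a function of $(x,y)\in\mathbb R^2$ via $q=x+Iy$, and $\overline{\partial_I}=\frac12\left(\frac{\partial}{\partial x}+I\frac{\partial}{\partial y}\right)$, with $I$ acting by left multiplication. For a nonnegative integer $n$, $\mathcal{SR}_n$ (S-polyregular functions of level $n$) is the set of (sufficiently real differentiable) functions $f:\mathbb H\to\mathbb H$ with $\overline{\partial_I}^{\,n+1}f_I=0$ on $\mathbb C_I$ for every $I\in\mathbb S$; $\mathcal{SR}=\mathcal{SR}_0$ is the space of (left) slice regular functions on $\mathbb H$. A function is S-polyregular if it belongs to $\mathcal{SR}_n$ for some $n\ge 0$. The dot product is the pointwise product $(f\cdot g)(q)=f(q)g(q)$. A right quaternionic polynomial function is a function of the form $q\mapsto\sum_{m=0}^M q^m\beta_m$ with $\beta_m\in\mathbb H$. For $f\in\mathcal{SR}$ and $I\perp J$ in $\mathbb S$, the Splitting Lemma guarantees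 that holomorphic $F_f,G_f:\mathbb C_I\to\mathbb C_I$ with $f_I=F_f+G_fJ$ exist (they are unique). *)

(* Defs.v *)
From Stdlib Require Import Reals.
From Coquelicot Require Import Coquelicot.

Open Scope R_scope.

(* (a, b, c, d) stands for a + b i + c j + d k; the topology and the real vector
   space structure are those of R^4. *)
Definition quat : Type := (R * R * R * R)%type.

Definition quat_normed : NormedModule R_AbsRing :=
  prod_NormedModule R_AbsRing
    (prod_NormedModule R_AbsRing
      (prod_NormedModule R_AbsRing R_NormedModule R_NormedModule)
      R_NormedModule)
    R_NormedModule.

Canonical quat_AbelianMonoid : AbelianMonoid :=
  AbelianMonoid.Pack quat (AbelianMonoid.class quat_normed) quat.
Canonical quat_AbelianGroup : AbelianGroup :=
  AbelianGroup.Pack quat (AbelianGroup.class quat_normed) quat.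
Canonical quat_UniformSpace : UniformSpace :=
  UniformSpace.Pack quat (UniformSpace.class quat_normed) quat.
Canonical quat_ModuleSpace : ModuleSpace R_Ring :=
  ModuleSpace.Pack R_Ring quat (ModuleSpace.class R_Ring quat_normed) quat.
Canonical quat_NormedModuleAux : NormedModuleAux R_AbsRing :=
  NormedModuleAux.Pack R_AbsRing quat
    (NormedModuleAux.class R_AbsRing quat_normed) quat.
Canonical quat_NormedModule : NormedModule R_AbsRing :=
  NormedModule.Pack R_AbsRing quat (NormedModule.class R_AbsRing quat_normed) quat.

Definition mkquat (a b c d : R) : quat := (a, b, c, d).
Definition q0 (q : quat) : R := fst (fst (fst q)).
Definition q1 (q : quat) : R := snd (fst (fst q)).
Definition q2 (q : quat) : R := snd (fst q).
Definition q3 (q : quat) : R := snd q.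

Definition qmult (p q : quat) : quat :=
  mkquat (q0 p * q0 q - q1 p * q1 q - q2 p * q2 q - q3 p * q3 q)
         (q0 p * q1 q + q1 p * q0 q + q2 p * q3 q - q3 p * q2 q)
         (q0 p * q2 q - q1 p * q3 q + q2 p * q0 q + q3 p * q1 q)
         (q0 p * q3 q + q1 p * q2 q - q2 p * q1 q + q3 p * q0 q).

Definition qone : quat := mkquat 1 0 0 0.

Lemma quat_eq (p q : quat) :
  q0 p = q0 q -> q1 p = q1 q -> q2 p = q2 q -> q3 p = q3 q -> p = q.
Proof.
destruct p as [[[a b] c] d]; destruct q as [[[a' b'] c'] d'].
unfold q0, q1, q2, q3; simpl; intros; subst; reflexivity.
Qed.

Lemma quat_Ring_mixin : Ring.mixin_of quat_AbelianGroup.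
Proof.
apply (Ring.Mixin quat_AbelianGroup qmult qone); intros;
  apply quat_eq; unfold qmult, qone, mkquat, q0, q1, q2, q3, plus; simpl;
  unfold plus; simpl; ring.
Defined.

Canonical quat_Ring : Ring :=
  Ring.Pack quat (Ring.Class quat (AbelianGroup.class quat_normed) quat_Ring_mixin)
    quat.

Definition sphere (I : quat) : Prop := mult I I = opp one.

Definition dot (p q : quat) : R :=
  q0 p * q0 q + q1 p * q1 q + q2 p * q2 q + q3 p * q3 q.

Definition perp (I J : quat) : Prop := dot I J = 0.

(* For I in the sphere, the identification of C with C_I, x + i y |-> x + I y. *)
Definition slice (I : quat) (z : C) : quat :=
  plus (scal (Re z) (one : quat)) (scal (Im z) I).

Definition restr (f : quat -> quat) (I : quat) (x y : R) : quat :=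
  f (slice I (x, y)).

Definition curve_derive (phi : R -> quat) (t : R) : quat :=
  mkquat (Derive (fun s => q0 (phi s)) t) (Derive (fun s => q1 (phi s)) t)
         (Derive (fun s => q2 (phi s)) t) (Derive (fun s => q3 (phi s)) t).

Definition dir_derive (f : quat -> quat) (v q : quat) : quat :=
  curve_derive (fun t => f (plus q (scal t v))) 0.

(* Functions of class C^k on R^4. *)
Fixpoint class_C (k : nat) (f : quat -> quat) : Prop :=
  match k with
  | O => forall q : quat, continuous f q
  | S k' => forall v : quat,
      (forall q : quat, ex_derive (fun t : R => f (plus q (scal t v))) 0) /\
      class_C k' (dir_derive f v)
  end.

Definition dbar (I : quat) (u : R -> R -> quat) (x y : R) : quat :=
  scal (1 / 2) (plus (curve_derive (fun s => u s y) x)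
                     (mult I (curve_derive (fun s => u x s) y))).

(* "Sufficiently real differentiable" is read as: of class C^(n+1) on H. *)
Definition SR (n : nat) (f : quat -> quat) : Prop :=
  class_C (S n) f /\
  forall I, sphere I ->
    forall x y : R, Nat.iter (S n) (dbar I) (restr f I) x y = zero.

Definition slice_regular (f : quat -> quat) : Prop := SR 0 f.

Definition S_polyregular (f : quat -> quat) : Prop := exists n : nat, SR n f.

Definition dot_product (f g : quat -> quat) (q : quat) : quat := mult (f q) (g q).

Definition right_polynomial (g : quat -> quat) : Prop :=
  exists (M : nat) (beta : nat -> quat),
    forall q : quat, g q = sum_n (fun m => mult (pow_n q m) (beta m)) M.

Definition holomorphic (F : C -> C) : Prop :=
  forall z : C, ex_derive (K := C_AbsRing) (V := C_NormedModule) F z.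

(* Main.v *)
(** A slice regular function is the sum of an everywhere convergent power series
    [sum q^n a_n]: on each slice this is Cauchy's formula, and the coefficients are read
    off the real axis, hence do not depend on the slice. Such series are smooth on H.

    For K in the sphere put [twist p = (p + K p K) / 2]; if [f_K = F + G K'] with K' orthogonal
    to K, then [twist f_K = G K']. On C_K one finds [dbar (f g) = twist f . g'], and since twist
    is idempotent [dbar^n (f g) = twist f . g^(n)] for n >= 1. This vanishes as soon as g is a
    polynomial of degree less than n. Conversely, if it vanishes on C_I, then on the real axis
    each product of a coordinate of [twist f] with a coordinate of [g^(n)] is a zero product of
    real power series; as [twist f = G J] is not identically zero, [g^(n) = 0]. *)

Require Import Defs.
From Stdlib Require Import Reals Psatz FunctionalExtensionality.
From Coquelicot Require Import Coquelicot.

Open Scope R_scope.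

(** The hypotheses on [f] and [g] provide class C^1 on H and an equation inside each slice, whereas
    [SR n] demands class C^(n+1) in all directions of R^4, also across the slices. Power series
    overcome this obstacle. In a direction v that does not commute with q, the derivative of q^n is
    a sum of terms q^i v q^j, so smoothness is drawn from norm bounds alone; derivatives are
    computed exactly only at points of C_K in the directions 1 and K, which is all that [dbar K]
    sees. A point where [twist f] is nonzero need not be real, while coordinates become real power
    series only on the real axis; the passage goes through the coefficients, to which [twist]
    applies term by term. No zero set has to be studied: the lowest nonzero coefficient decides. *)

(** * Cauchy's integral theorem for pairs of conjugate real functions *)

Definition conjugate_pair (u v ux uy : R -> R -> R) : Prop :=
  forall x y : R,
    is_derive (fun s => u s y) x (ux x y) /\
    is_derive (fun s => u x s) y (uy x y) /\
    is_derive (fun s => v s y) x (- uy x y) /\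
    is_derive (fun s => v x s) y (ux x y) /\
    continuity_2d_pt ux x y /\ continuity_2d_pt uy x y.

Lemma C1_differentiable (u ux uy : R -> R -> R) :
  (forall x y, is_derive (fun s => u s y) x (ux x y)) ->
  (forall x y, is_derive (fun s => u x s) y (uy x y)) ->
  (forall x y, continuity_2d_pt ux x y) ->
  forall x y, differentiable_pt_lim u x y (ux x y) (uy x y).
Proof.
intros Hx Hy Cx x y.
apply filterdiff_differentiable_pt_lim.
assert (H := is_derive_filterdiff u x y ux (uy x y)).
apply H.
- exists (mkposreal 1 Rlt_0_1). intros [a b] _. apply Hx.
- apply Hy.
- apply (proj1 (continuity_2d_pt_filterlim _ _ _) (Cx x y)).
Qed.

Lemma is_derive_curve (u ux uy : R -> R -> R) (f g : R -> R) (t df dg : R) :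
  (forall x y, is_derive (fun s => u s y) x (ux x y)) ->
  (forall x y, is_derive (fun s => u x s) y (uy x y)) ->
  (forall x y, continuity_2d_pt ux x y) ->
  is_derive f t df -> is_derive g t dg ->
  is_derive (fun s => u (f s) (g s)) t
    (ux (f t) (g t) * df + uy (f t) (g t) * dg).
Proof.
intros Hx Hy Cx Hf Hg.
apply is_derive_Reals.
apply derivable_pt_lim_comp_2d; try now apply is_derive_Reals.
now apply C1_differentiable.
Qed.

(** Multiplication of u + i v by -i. It carries statements on the real part of a holomorphic
    function over to the imaginary part. *)
Lemma conjugate_pair_rotate (u v ux uy : R -> R -> R) :
  conjugate_pair u v ux uy ->
  conjugate_pair v (fun x y => - u x y) (fun x y => - uy x y) ux.
Proof.
intros H x y; destruct (H x y) as (H1 & H2 & H3 & H4 & H5 & H6).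
refine (conj H3 (conj H4 (conj _ (conj _ (conj _ H5))))).
- apply (is_derive_opp (fun s => u s y)). exact H1.
- apply (is_derive_opp (fun s => u x s)). exact H2.
- now apply continuity_2d_pt_opp.
Qed.

Lemma conjugate_pair_continuous (u v ux uy : R -> R -> R) :
  conjugate_pair u v ux uy ->
  forall x y, continuity_2d_pt u x y /\ continuity_2d_pt v x y.
Proof.
intros H x y; split; apply differentiable_continuity_pt.
- exists (ux x y), (uy x y). apply C1_differentiable; intros; apply H.
- exists (- uy x y), (ux x y).
  apply (C1_differentiable v (fun x y => - uy x y) ux); intros.
  + apply H.
  + apply H.
  + apply continuity_2d_pt_opp, H.
Qed.

Lemma continuous_comp_2d (h : R -> R -> R) {T : UniformSpace} (f g : T -> R) (t : T) :
  (forall x y, continuity_2d_pt h x y) ->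
  continuous f t -> continuous g t -> continuous (fun s => h (f s) (g s)) t.
Proof.
intros Hh Hf Hg.
apply (continuous_comp_2 f g h t Hf Hg).
apply (proj1 (continuity_2d_pt_filterlim _ _ _) (Hh (f t) (g t))).
Qed.

Lemma continuous_cos_sin (th : R) : continuous cos th /\ continuous sin th.
Proof.
split; apply continuity_pt_filterlim; [apply continuity_cos | apply continuity_sin].
Qed.

Lemma ex_RInt_cont (f : R -> R) a b : (forall t, continuous f t) -> ex_RInt f a b.
Proof. intros H; apply (ex_RInt_continuous (V := R_CompleteNormedModule)); auto. Qed.

Ltac cont :=
  intros;
  repeat
  match goal with
  | H : ?P |- ?P => exact H
  | |- continuous (fun x => _ + _) _ => apply (continuous_plus (V := R_NormedModule))
  | |- continuous (fun x => _ - _) _ => apply (continuous_minus (V := R_NormedModule))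
  | |- continuous (fun x => - _) _ => apply (continuous_opp (V := R_NormedModule))
  | |- continuous (fun x => _ * _) _ => apply (continuous_mult (K := R_AbsRing))
  | |- continuous (fun x => fst x) _ => apply continuous_fst
  | |- continuous (fun x => snd x) _ => apply continuous_snd
  | |- continuous fst _ => apply continuous_fst
  | |- continuous snd _ => apply continuous_snd
  | |- continuous (fun x => x) _ => apply continuous_id
  | |- continuous (fun x => ?c) _ => apply continuous_const
  | |- continuous (fun x => cos x) _ => apply (proj1 (continuous_cos_sin _))
  | |- continuous (fun x => sin x) _ => apply (proj2 (continuous_cos_sin _))
  | |- continuous cos _ => apply (proj1 (continuous_cos_sin _))
  | |- continuous sin _ => apply (proj2 (continuous_cos_sin _))
  | |- continuous (fun x => ?h (@?f x) (@?g x)) _ =>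
      first [apply (continuous_comp_2d h f g); [solve [auto] | |]]
  | H : forall _, continuous ?f _ |- continuous (fun x => ?f x) _ => apply H
  | H : forall _, continuous ?f _ |- continuous ?f _ => apply H
  | H : forall _ _, continuous (fun x => ?f _ x) _ |- continuous (fun x => ?f _ x) _ => apply H
  end.

(* Cauchy's formula for a kernel [kr + i ki] equal to [zeta / (zeta - w)] on the circle:
   the integral of the kernel times [h (w + t (zeta - w))] has a t-derivative which is
   1/t times the integral of a theta-derivative. *)
Lemma cauchy_mean (u v ux uy : R -> R -> R) (a b r : R) (kr ki : R -> R) :
  conjugate_pair u v ux uy ->
  (forall th, continuous kr th) -> (forall th, continuous ki th) ->
  (forall th, kr th * (r * cos th - a) - ki th * (r * sin th - b) = r * cos th) ->
  (forall th, kr th * (r * sin th - b) + ki th * (r * cos th - a) = r * sin th) ->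
  RInt (fun th => kr th * u (r * cos th) (r * sin th)
                  - ki th * v (r * cos th) (r * sin th)) 0 (2 * PI) =
  RInt (fun th => kr th * u a b - ki th * v a b) 0 (2 * PI).
Proof.
intros H Ckr Cki Hk1 Hk2.
assert (Cu : forall x y, continuity_2d_pt u x y) by (intros x y; apply (proj1 (conjugate_pair_continuous _ _ _ _ H x y))).
assert (Cv : forall x y, continuity_2d_pt v x y) by (intros x y; apply (proj2 (conjugate_pair_continuous _ _ _ _ H x y))).
assert (Cux : forall x y, continuity_2d_pt ux x y) by (intros; apply H).
assert (Cuy : forall x y, continuity_2d_pt uy x y) by (intros; apply H).
(* Contraction of the circle to the point w = a + i b: t = 1 gives the circle, t = 0 the constant
   w. *)
set (X := fun t th => a + t * (r * cos th - a)).
set (Y := fun t th => b + t * (r * sin th - b)).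
set (f := fun t th => kr th * u (X t th) (Y t th) - ki th * v (X t th) (Y t th)).
set (df := fun t th => ux (X t th) (Y t th) * (r * cos th) + uy (X t th) (Y t th) * (r * sin th)).
assert (Hf : forall t th, is_derive (fun s => f s th) t (df t th)).
{ intros t th.
  assert (HX : is_derive (fun s => X s th) t (r * cos th - a)) by (unfold X; auto_derive; auto; ring).
  assert (HY : is_derive (fun s => Y s th) t (r * sin th - b)) by (unfold Y; auto_derive; auto; ring).
  assert (Hu := is_derive_curve u ux uy _ _ t _ _ (fun x y => proj1 (H x y)) (fun x y => proj1 (proj2 (H x y))) Cux HX HY).
  assert (Hv : is_derive (fun s => v (X s th) (Y s th)) t
     (- uy (X t th) (Y t th) * (r * cos th - a) + ux (X t th) (Y t th) * (r * sin th - b))).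
  { apply (is_derive_curve v (fun x y => - uy x y) ux (fun s => X s th) (fun s => Y s th)); auto; intros; try apply H.
    apply continuity_2d_pt_opp, H. }
  unfold f.
  replace (df t th) with
    (kr th * (ux (X t th) (Y t th) * (r * cos th - a) + uy (X t th) (Y t th) * (r * sin th - b))
     - ki th * (- uy (X t th) (Y t th) * (r * cos th - a) + ux (X t th) (Y t th) * (r * sin th - b))).
  - apply (is_derive_minus (V := R_NormedModule)); apply is_derive_scal; assumption.
  (* Grouping by [ux] and [uy] exhibits the real and imaginary parts of the kernel times zeta - w,
     that is, of zeta. *)
  - transitivity (ux (X t th) (Y t th) * (kr th * (r * cos th - a) - ki th * (r * sin th - b))
      + uy (X t th) (Y t th) * (kr th * (r * sin th - b) + ki th * (r * cos th - a))); [ring|].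
    now rewrite Hk1, Hk2. }
assert (CX : forall t th, continuous (fun s => X t s) th) by (intros; unfold X; cont).
assert (CY : forall t th, continuous (fun s => Y t s) th) by (intros; unfold Y; cont).
assert (HA : forall t, is_derive (fun s => RInt (f s) 0 (2 * PI)) t (RInt (df t) 0 (2 * PI))).
{ intros t.
  replace (RInt (df t) 0 (2*PI)) with (RInt (fun th => Derive (fun s => f s th) t) 0 (2 * PI)).
  2:{ apply RInt_ext; intros; apply is_derive_unique, Hf. }
  apply is_derive_RInt_param.
  - apply filter_forall; intros s th _; eexists; apply Hf.
  - intros th _.
    apply continuity_2d_pt_ext with df.
    { intros; symmetry; apply is_derive_unique, Hf. }
    apply continuity_2d_pt_filterlim.
    change (continuous (fun z : R * R => df (fst z) (snd z)) (t, th)).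
    assert (C1 : continuous (fun z : R * R => cos (snd z)) (t, th)).
    { apply (continuous_comp snd cos); [apply continuous_snd|cont]. }
    assert (C2 : continuous (fun z : R * R => sin (snd z)) (t, th)).
    { apply (continuous_comp snd sin); [apply continuous_snd|cont]. }
    assert (C3 : continuous (fun z : R * R => X (fst z) (snd z)) (t, th))  by (unfold X; cont).
    assert (C4 : continuous (fun z : R * R => Y (fst z) (snd z)) (t, th)) by (unfold Y; cont).
    unfold df.
    cont.
  - apply filter_forall; intros s. apply ex_RInt_cont; intros th.
    unfold f. cont. }
assert (Hdf : forall t, t <> 0 -> RInt (df t) 0 (2 * PI) = 0).
{ intros t Ht.
  (* With h = u + i v, [df] is Re (h' zeta), and along the contracted circle dh / dtheta = i t h'
     zeta. Hence v / t is a primitive of [df] in theta, and it is periodic. *)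
  assert (D : forall th, is_derive (fun s => / t * v (X t s) (Y t s)) th (df t th)).
  { intros th.
    replace (df t th) with (/ t * (- uy (X t th) (Y t th) * (t * (r * - sin th))
        + ux (X t th) (Y t th) * (t * (r * cos th)))).
    2:{ unfold df; field; auto. }
    apply is_derive_scal.
    apply (is_derive_curve v (fun x y => - uy x y) ux (X t) (Y t)); intros; try apply H.
    - apply continuity_2d_pt_opp, H.
    - unfold X; auto_derive; auto; ring.
    - unfold Y; auto_derive; auto; ring. }
  assert (HI := is_RInt_derive (V := R_CompleteNormedModule) _ _ 0 (2 * PI) (fun x _ => D x)).
  apply (is_RInt_unique (V := R_CompleteNormedModule)).
  replace 0 with (minus (/ t * v (X t (2 * PI)) (Y t (2 * PI))) (/ t * v (X t 0) (Y t 0))) at 2.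
  - apply HI. intros th _. unfold df. cont.
  - unfold X, Y. rewrite cos_2PI, sin_2PI, cos_0, sin_0. apply (minus_eq_zero (G := R_AbelianGroup)). }
assert (E : RInt (f 1) 0 (2 * PI) = RInt (f 0) 0 (2 * PI)).
{ destruct (MVT_gen (fun s => RInt (f s) 0 (2*PI)) 0 1 (fun s => RInt (df s) 0 (2*PI))) as [c [_ Hc]].
  - intros; apply HA.
  - intros; apply derivable_continuous_pt. eexists. apply is_derive_Reals, HA.
  (* The point c may be the endpoint 0, where [Hdf] is silent; a second mean value argument then
     uses the derivative on the open interval only. *)
  - destruct (Req_dec c 0) as [Z|Z].
    + destruct (MVT_gen (fun s => RInt (f s) 0 (2*PI)) 0 1 (fun s => 0)) as [d [_ Hd]].
      * intros s Hs. rewrite Rmin_left in Hs by lra. assert (Hs' := HA s). rewrite Hdf in Hs' by lra. exact Hs'.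
      * intros; apply derivable_continuous_pt. eexists. apply is_derive_Reals, HA.
      * lra.
    + rewrite Hdf in Hc; auto; lra. }
assert (X1 : forall th, X 1 th = r * cos th) by (intros; unfold X; ring).
assert (Y1 : forall th, Y 1 th = r * sin th) by (intros; unfold Y; ring).
assert (X0 : forall th, X 0 th = a) by (intros; unfold X; ring).
assert (Y0 : forall th, Y 0 th = b) by (intros; unfold Y; ring).
etransitivity; [|etransitivity; [exact E|]]; apply RInt_ext; intros th _; unfold f.
- now rewrite X1, Y1.
- now rewrite X0, Y0.
Qed.

(** * Integrals over a circle and the expansion into a power series *)

Definition CInt (h : R -> C) : C :=
  (RInt (fun t => Re (h t)) 0 (2 * PI), RInt (fun t => Im (h t)) 0 (2 * PI)).

Definition Ccont (h : R -> C) : Prop :=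
  forall t, continuous (fun s => Re (h s)) t /\ continuous (fun s => Im (h s)) t.

Lemma Re_mult (z w : C) : Re (z * w)%C = Re z * Re w - Im z * Im w.
Proof. reflexivity. Qed.

Lemma Im_mult (z w : C) : Im (z * w)%C = Re z * Im w + Im z * Re w.
Proof. reflexivity. Qed.

Lemma Ccont_Re (h : R -> C) : Ccont h -> forall t, continuous (fun s => Re (h s)) t.
Proof. intros H t; exact (proj1 (H t)). Qed.

Lemma Ccont_Im (h : R -> C) : Ccont h -> forall t, continuous (fun s => Im (h s)) t.
Proof. intros H t; exact (proj2 (H t)). Qed.

Lemma Ccont_const (z : C) : Ccont (fun _ => z).
Proof. intros t; split; apply continuous_const. Qed.

Lemma Ccont_mult (h k : R -> C) : Ccont h -> Ccont k -> Ccont (fun t => (h t * k t)%C).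
Proof.
intros Hh Hk t; destruct (Hh t), (Hk t); unfold Re, Im, Cmult in *; simpl; split; cont.
Qed.

Lemma Ccont_pow (h : R -> C) n : Ccont h -> Ccont (fun t => (h t ^ n)%C).
Proof.
intros Hh; induction n as [|n IH].
- apply (Ccont_const 1).
- apply (Ccont_mult h _ Hh IH).
Qed.

Lemma RInt_Rscal (c : R) (k : R -> R) a b : (forall t, continuous k t) ->
  RInt (fun t => c * k t) a b = c * RInt k a b.
Proof.
intros Hk; apply (RInt_scal (V := R_CompleteNormedModule)). now apply ex_RInt_cont.
Qed.

Lemma CInt_scal (z : C) (h : R -> C) : Ccont h -> CInt (fun t => (z * h t)%C) = (z * CInt h)%C.
Proof.
intros Hh.
assert (I1 : forall t, continuous (fun t => Re (h t)) t) by exact (Ccont_Re h Hh).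
assert (I2 : forall t, continuous (fun t => Im (h t)) t) by exact (Ccont_Im h Hh).
assert (S : forall c k, (forall t : R, continuous k t) -> ex_RInt (fun t => c * k t) 0 (2 * PI)).
{ intros c k Hk. apply (ex_RInt_scal (V := R_NormedModule)). now apply ex_RInt_cont. }
apply injective_projections.
- transitivity (fst z * RInt (fun t => Re (h t)) 0 (2 * PI) - snd z * RInt (fun t => Im (h t)) 0 (2 * PI));
    [|reflexivity].
  rewrite <- 2!RInt_Rscal by assumption.
  apply (RInt_minus (V := R_CompleteNormedModule)); now apply S.
- transitivity (fst z * RInt (fun t => Im (h t)) 0 (2 * PI) + snd z * RInt (fun t => Re (h t)) 0 (2 * PI));
    [|reflexivity].
  rewrite <- 2!RInt_Rscal by assumption.
  apply (RInt_plus (V := R_CompleteNormedModule)); now apply S.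
Qed.

Lemma CInt_ext (h k : R -> C) : (forall t, h t = k t) -> CInt h = CInt k.
Proof. intros H; unfold CInt; f_equal; apply RInt_ext; intros; now rewrite H. Qed.

Lemma CInt_plus (h k : R -> C) :
  Ccont h -> Ccont k -> CInt (fun t => (h t + k t)%C) = (CInt h + CInt k)%C.
Proof.
intros Hh Hk; apply injective_projections; apply (RInt_plus (V := R_CompleteNormedModule));
  apply ex_RInt_cont;
  first [exact (Ccont_Re h Hh) | exact (Ccont_Im h Hh) | exact (Ccont_Re k Hk) | exact (Ccont_Im k Hk)].
Qed.

Lemma Cmod_Re (z : C) : Rabs (Re z) <= Cmod z.
Proof.
unfold Cmod, Re. rewrite <- sqrt_Rsqr_abs. apply sqrt_le_1_alt. unfold Rsqr.
nra.
Qed.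

Lemma CInt_Re_bound (h : R -> C) (g : R -> R) (M : R) : Ccont h ->
  (forall t, continuous g t) -> (forall t, Rabs (Re (h t)) <= M * g t) ->
  Rabs (Re (CInt h)) <= M * RInt g 0 (2 * PI).
Proof.
intros Hh Hg HM.
assert (P := PI_RGT_0).
unfold CInt, Re; simpl.
apply Rle_trans with (RInt (fun t => Rabs (Re (h t))) 0 (2 * PI)).
- apply abs_RInt_le; [lra|]. apply ex_RInt_cont. exact (Ccont_Re h Hh).
- rewrite <- RInt_Rscal by assumption.
  apply RInt_le; [lra| | | intros; apply HM].
  + apply ex_RInt_cont; intros. apply (continuous_comp (fun t => Re (h t)) Rabs).
    exact (Ccont_Re h Hh t). apply continuous_Rabs.
  + apply (ex_RInt_scal (V := R_NormedModule)). now apply ex_RInt_cont.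
Qed.

Definition circ (r t : R) : C := (r * cos t, r * sin t).
(** For r > 0 this is the inverse of [circ r t], written out so that its powers follow from de
    Moivre's formula and its continuity is immediate. *)
Definition circ_inv (r t : R) : C := (cos t / r, - sin t / r).

Lemma Ccont_circ_inv r : Ccont (circ_inv r).
Proof. intros t; unfold circ_inv, Re, Im, Rdiv; simpl; split; cont. Qed.

Lemma circ_inv_pow r n t : 0 < r ->
  (circ_inv r t ^ n)%C = (cos (INR n * t) / r ^ n, - sin (INR n * t) / r ^ n).
Proof.
intros Hr; induction n as [|n IH].
- simpl. rewrite Rmult_0_l, cos_0, sin_0. apply injective_projections; simpl; field.
- replace (circ_inv r t ^ S n)%C with (circ_inv r t * circ_inv r t ^ n)%C by reflexivity.
  rewrite IH, S_INR.
  replace ((INR n + 1) * t) with (INR n * t + t) by ring.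
  rewrite cos_plus, sin_plus.
  apply injective_projections; simpl; field; split; try lra; apply pow_nonzero; lra.
Qed.

Lemma CInt_circ_inv_pow r n : 0 < r ->
  CInt (fun t => (circ_inv r t ^ n)%C) = RtoC (match n with O => 2 * PI | S _ => 0 end).
Proof.
intros Hr; destruct n as [|n].
- unfold CInt, Re, Im, RtoC; simpl.
  rewrite !(RInt_const (V := R_CompleteNormedModule)). unfold scal; simpl; unfold mult; simpl.
  f_equal; ring.
- assert (Hn : INR (S n) <> 0) by (apply not_0_INR; lia).
  assert (Hrn : r ^ S n <> 0) by (apply pow_nonzero; lra).
  assert (S2 : sin (INR (S n) * (2 * PI)) = 0).
  { replace (INR (S n) * (2 * PI)) with (0 + 2 * INR (S n) * PI) by ring.
    now rewrite sin_period, sin_0. }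
  assert (C2 : cos (INR (S n) * (2 * PI)) = 1).
  { replace (INR (S n) * (2 * PI)) with (0 + 2 * INR (S n) * PI) by ring.
    now rewrite cos_period, cos_0. }
  rewrite (CInt_ext _ _ (fun t => circ_inv_pow r (S n) t Hr)).
  set (k := INR (S n)) in *. set (p := r ^ S n) in *.
  unfold CInt, Re, Im, RtoC; simpl; f_equal.
  + apply (is_RInt_unique (V := R_CompleteNormedModule)).
    replace 0 with (minus (sin (k * (2 * PI)) / k / p) (sin (k * 0) / k / p)) at 2.
    * apply (is_RInt_derive (V := R_CompleteNormedModule) (fun t => sin (k * t) / k / p)).
      -- intros; auto_derive; auto. field; auto.
      -- intros. apply (ex_derive_continuous (V := R_NormedModule)). auto_derive; auto.
    * rewrite S2, Rmult_0_r, sin_0. apply (minus_eq_zero (G := R_AbelianGroup)).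
  + apply (is_RInt_unique (V := R_CompleteNormedModule)).
    replace 0 with (minus (cos (k * (2 * PI)) / k / p) (cos (k * 0) / k / p)) at 2.
    * apply (is_RInt_derive (V := R_CompleteNormedModule) (fun t => cos (k * t) / k / p)).
      -- intros; auto_derive; auto. field; auto.
      -- intros. apply (ex_derive_continuous (V := R_NormedModule)). auto_derive; auto.
    * rewrite C2, Rmult_0_r, cos_0. apply (minus_eq_zero (G := R_AbelianGroup)).
Qed.

(** As zeta = r e^(i t) satisfies d zeta = i zeta dt, this is Cauchy's kernel 1 / (zeta - w) once
    the factor i is taken out, which leaves 2 PI as normalisation. *)
Definition cauchy_kernel (r : R) (w : C) (t : R) : C := (circ r t / (circ r t - w))%C.

Lemma Cmod_circ r t : 0 < r -> Cmod (circ r t) = r.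
Proof.
intros Hr; unfold circ, Cmod; simpl.
replace (_ + _) with (r ^ 2 * ((sin t)² + (cos t)²)) by (unfold Rsqr; ring).
rewrite sin2_cos2, Rmult_1_r. apply sqrt_pow2; lra.
Qed.

Lemma circ_minus_neq0 r w t : 0 < r -> Cmod w < r -> (circ r t - w)%C <> RtoC 0.
Proof.
intros Hr Hw E.
assert (circ r t = w).
{ replace (circ r t) with (circ r t - w + w)%C by ring. rewrite E. ring. }
rewrite <- H, Cmod_circ in Hw; lra.
Qed.

Lemma circ_mult_inv r t : 0 < r -> (circ r t * circ_inv r t)%C = RtoC 1.
Proof.
intros Hr; unfold circ, circ_inv, Cmult, RtoC; simpl.
assert (E := sin2_cos2 t); unfold Rsqr in E.
f_equal; [|field; lra].
replace 1 with (sin t * sin t + cos t * cos t). field; lra.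
Qed.

Lemma cauchy_kernel_step r w t : 0 < r -> Cmod w < r ->
  cauchy_kernel r w t = (1 + w * circ_inv r t * cauchy_kernel r w t)%C.
Proof.
intros Hr Hw.
assert (H := circ_minus_neq0 r w t Hr Hw).
assert (E := circ_mult_inv r t Hr).
unfold cauchy_kernel.
replace (w * circ_inv r t * (circ r t / (circ r t - w)))%C
  with (w * (circ r t * circ_inv r t) / (circ r t - w))%C by (field; auto).
rewrite E. field; auto.
Qed.

Lemma Ccont_cauchy_kernel r w : 0 < r -> Cmod w < r -> Ccont (cauchy_kernel r w).
Proof.
intros Hr Hw.
assert (H : forall t, (Re (circ r t - w))%C ^ 2 + (Im (circ r t - w)%C) ^ 2 <> 0).
{ intros t E. apply (circ_minus_neq0 r w t Hr Hw).
  assert (P := pow2_ge_0 (Re (circ r t - w)%C)). assert (P' := pow2_ge_0 (Im (circ r t - w)%C)).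
  apply injective_projections; apply Rsqr_0_uniq; rewrite Rsqr_pow2; unfold Re, Im in *; lra. }
apply Ccont_mult.
- intros t; unfold circ, Re, Im; simpl; split; cont.
- intros t; specialize (H t). unfold Re, Im in *; simpl in *. unfold Cinv; simpl.
  split; apply (ex_derive_continuous (V := R_NormedModule)); auto_derive; repeat split; auto.
Qed.

Lemma Cmod_circ_inv r t : 0 < r -> Cmod (circ_inv r t) = / r.
Proof.
intros Hr.
assert (E := f_equal Cmod (circ_mult_inv r t Hr)).
rewrite Cmod_mult, Cmod_circ, Cmod_1 in E by auto.
apply Rmult_eq_reg_l with r; [|lra]. rewrite E. field; lra.
Qed.

Lemma continuous_Cmod (h : R -> C) : Ccont h -> forall t, continuous (fun s => Cmod (h s)) t.
Proof.
intros Hh t. destruct (Hh t). unfold Cmod.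
apply (continuous_comp (fun s => fst (h s) ^ 2 + snd (h s) ^ 2) sqrt).
- unfold Re, Im in *. simpl. cont.
- apply continuous_sqrt.
Qed.

(* The expansion [zeta / (zeta - w) = sum_(k < n) (w / zeta)^k + (w / zeta)^n zeta / (zeta - w)],
   integrated against h. *)
Lemma cauchy_series (r : R) (w : C) (h : R -> C) :
  0 < r -> Cmod w < r -> Ccont h ->
  is_series (fun n => Re (w ^ n * CInt (fun t => circ_inv r t ^ n * h t))%C)
    (Re (CInt (fun t => cauchy_kernel r w t * h t))%C).
Proof.
intros Hr Hw Hh.
assert (Hk := Ccont_cauchy_kernel r w Hr Hw).
assert (Hi := Ccont_circ_inv r).
(* [J n] is the remainder after the first n terms; by [HJ] the partial sums telescope. *)
set (J := fun n => (w ^ n * CInt (fun t => circ_inv r t ^ n * (cauchy_kernel r w t * h t)))%C).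
assert (HJ : forall n, Re (J n) = Re (w ^ n * CInt (fun t => circ_inv r t ^ n * h t))%C + Re (J (S n))).
{ intros n. unfold J.
  rewrite (CInt_ext _ (fun t => circ_inv r t ^ n * h t +
     w * (circ_inv r t ^ S n * (cauchy_kernel r w t * h t)))%C).
  2:{ intros t. rewrite (cauchy_kernel_step r w t Hr Hw) at 1.
      replace (circ_inv r t ^ S n)%C with (circ_inv r t * circ_inv r t ^ n)%C by reflexivity. ring. }
  assert (H1 : Ccont (fun t => circ_inv r t ^ n * h t)%C) by (apply Ccont_mult; auto; now apply Ccont_pow).
  assert (H2 : Ccont (fun t => circ_inv r t ^ S n * (cauchy_kernel r w t * h t))%C).
  { apply Ccont_mult; [now apply Ccont_pow|now apply Ccont_mult]. }
  rewrite CInt_plus, CInt_scal; auto.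
  2:{ apply (Ccont_mult (fun _ => w)); auto. apply Ccont_const. }
  replace (w ^ S n)%C with (w * w ^ n)%C by reflexivity.
  unfold Re. match goal with |- fst ?A = fst ?B + fst ?D => change (fst B + fst D) with (fst (B + D)%C) end.
  f_equal. ring. }
assert (HS : forall n, sum_n (fun n => Re (w ^ n * CInt (fun t => circ_inv r t ^ n * h t))%C) n
    = Re (J 0%nat) - Re (J (S n))).
{ induction n as [|n IH].
  - rewrite sum_O. rewrite (HJ 0%nat). match goal with |- @eq _ ?a ?b => change (@eq R a b) end. ring.
  - rewrite sum_Sn, IH, (HJ (S n)).
    match goal with |- @eq _ (plus ?a ?b) ?d => change (@eq R (a + b) d) end. ring. }
assert (J0 : Re (CInt (fun t => cauchy_kernel r w t * h t))%C = Re (J 0%nat)).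
{ f_equal. unfold J.
  transitivity (1 * CInt (fun t => cauchy_kernel r w t * h t))%C; [ring|].
  f_equal; apply CInt_ext; intros; simpl; ring. }
rewrite J0.
match goal with |- is_series ?a ?l => change (is_lim_seq (sum_n a) (Finite l)) end.
apply (is_lim_seq_ext (fun n => Re (J 0%nat) - Re (J (S n)))); [intros; now rewrite HS|].
replace (Finite (Re (J 0%nat))) with (Finite (Re (J 0%nat) - 0)) by (f_equal; ring).
apply is_lim_seq_minus'; [apply is_lim_seq_const|].
apply (is_lim_seq_incr_1 (fun n => Re (J n))).
set (M := RInt (fun t => Cmod (cauchy_kernel r w t * h t)%C) 0 (2 * PI)).
assert (HB : forall n, Rabs (Re (J n)) <= (Cmod w / r) ^ n * M).
{ intros n. unfold J.
  rewrite <- CInt_scal.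
  2:{ apply Ccont_mult; [now apply Ccont_pow|now apply Ccont_mult]. }
  apply CInt_Re_bound.
  - apply (Ccont_mult (fun _ => w ^ n)%C); [apply Ccont_const|].
    apply Ccont_mult; [now apply Ccont_pow|now apply Ccont_mult].
  - apply continuous_Cmod. now apply Ccont_mult.
  - intros t. eapply Rle_trans; [apply Cmod_Re|].
    rewrite 2!Cmod_mult, 2!Cmod_pow, Cmod_circ_inv by auto.
    unfold Rdiv. rewrite Rpow_mult_distr. apply Req_le; ring. }
assert (Hq : 0 <= Cmod w / r < 1).
{ split. apply Rdiv_le_0_compat; [apply Cmod_ge_0|lra]. apply Rmult_lt_reg_r with r; auto.
  unfold Rdiv. rewrite Rmult_assoc, Rinv_l; lra. }
assert (HG : is_lim_seq (fun n => (Cmod w / r) ^ n * M) 0).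
{ replace (Finite 0) with (Rbar_mult 0 M) by (simpl; f_equal; ring).
  apply is_lim_seq_scal_r. apply is_lim_seq_geom. rewrite Rabs_pos_eq; lra. }
apply is_lim_seq_abs_0.
apply (is_lim_seq_le_le (fun _ => 0) _ (fun n => (Cmod w / r) ^ n * M)); auto.
- intros n; split; auto. apply Rabs_pos.
- apply is_lim_seq_const.
Qed.

Lemma is_series_first (a : nat -> R) : (forall n, a (S n) = 0) -> is_series a (a 0%nat).
Proof.
intros H.
change (is_lim_seq (sum_n a) (a 0%nat)).
apply (is_lim_seq_ext (fun _ => a 0%nat)); [|apply is_lim_seq_const].
induction n as [|n IH]; [now rewrite sum_O|].
rewrite sum_Sn, <- IH, H. symmetry. apply Rplus_0_r.
Qed.

(** Cauchy's formula for constants, obtained from the geometric expansion of the kernel: all powers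
    of 1 / zeta but the zeroth integrate to 0 over the circle. *)
Lemma CInt_cauchy_kernel_const (r : R) (w z : C) : 0 < r -> Cmod w < r ->
  Re (CInt (fun t => cauchy_kernel r w t * z)%C) = 2 * PI * Re z.
Proof.
intros Hr Hw.
assert (H := cauchy_series r w (fun _ => z) Hr Hw (Ccont_const z)).
assert (E : forall n, CInt (fun t => (circ_inv r t ^ n * z)%C) =
   (z * RtoC (match n with O => 2 * PI | S _ => 0 end))%C).
{ intros n. rewrite <- (CInt_circ_inv_pow r n Hr), <- CInt_scal.
  - apply CInt_ext; intros; ring.
  - apply Ccont_pow, Ccont_circ_inv. }
apply is_series_unique in H. rewrite <- H.
etransitivity; [apply is_series_unique, is_series_first|].
- intros n. rewrite E, Cmult_0_r, Cmult_0_r. reflexivity.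
- rewrite E. unfold Re; simpl; ring.
Qed.

Definition on_circle (u v : R -> R -> R) (r t : R) : C :=
  (u (r * cos t) (r * sin t), v (r * cos t) (r * sin t)).

Definition circle_coef (u v : R -> R -> R) (r : R) (n : nat) : C :=
  (/ RtoC (2 * PI) * CInt (fun t => circ_inv r t ^ n *
      on_circle u v r t))%C.

Lemma Ccont_on_circle (u v : R -> R -> R) r :
  (forall x y, continuity_2d_pt u x y) -> (forall x y, continuity_2d_pt v x y) ->
  Ccont (on_circle u v r).
Proof. intros Cu Cv t; unfold on_circle, Re, Im; simpl; split; cont. Qed.

(** One integral is evaluated twice. [cauchy_mean] replaces the values on the circle by the value at
    w, leaving the integral of the kernel times a constant; [cauchy_series] expands the same
    integral in powers of w. *)
Lemma cauchy_formula (u v ux uy : R -> R -> R) (r : R) (w : C) :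
  conjugate_pair u v ux uy -> 0 < r -> Cmod w < r ->
  is_series (fun n => Re (w ^ n * circle_coef u v r n)%C) (u (Re w) (Im w)).
Proof.
intros H Hr Hw.
assert (Cu : forall x y, continuity_2d_pt u x y) by (intros x y; apply (proj1 (conjugate_pair_continuous _ _ _ _ H x y))).
assert (Cv : forall x y, continuity_2d_pt v x y) by (intros x y; apply (proj2 (conjugate_pair_continuous _ _ _ _ H x y))).
assert (Hh := Ccont_on_circle u v r Cu Cv).
assert (Hk := Ccont_cauchy_kernel r w Hr Hw).
assert (P := PI_RGT_0).
assert (Hs := cauchy_series r w _ Hr Hw Hh).
assert (E : Re (CInt (fun t => cauchy_kernel r w t * on_circle u v r t)%C)
  = 2 * PI * u (Re w) (Im w)).
{ etransitivity; [|exact (CInt_cauchy_kernel_const r w (u (Re w) (Im w), v (Re w) (Im w)) Hr Hw)].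
  assert (Hm : forall t, (cauchy_kernel r w t * (circ r t - w))%C = circ r t).
  { intros t. unfold cauchy_kernel. field. now apply circ_minus_neq0. }
  apply (cauchy_mean u v ux uy (Re w) (Im w) r (fun t => Re (cauchy_kernel r w t)) (fun t => Im (cauchy_kernel r w t)) H
    (Ccont_Re _ Hk) (Ccont_Im _ Hk)).
  - intros t. exact (f_equal Re (Hm t)).
  - intros t. exact (f_equal Im (Hm t)). }
rewrite E in Hs.
apply (is_series_scal_l (/ (2 * PI))) in Hs.
replace (u (Re w) (Im w)) with (/ (2 * PI) * (2 * PI * u (Re w) (Im w))) by (field; lra).
revert Hs; apply is_series_ext; intros n.
unfold circle_coef.
rewrite <- RtoC_inv by lra.
set (z := CInt _). change (/ (2 * PI) * Re (w ^ n * z)%C = Re (w ^ n * (RtoC (/ (2 * PI)) * z))%C).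
unfold Re; simpl; ring.
Qed.

Lemma circle_coef_rotate (u v : R -> R -> R) (r : R) n :
  (forall x y, continuity_2d_pt u x y) -> (forall x y, continuity_2d_pt v x y) ->
  circle_coef v (fun x y => - u x y) r n = (- Ci * circle_coef u v r n)%C.
Proof.
intros Cu Cv. unfold circle_coef.
rewrite (CInt_ext _ (fun t => - Ci * (circ_inv r t ^ n *
    on_circle u v r t))%C).
- rewrite CInt_scal.
  + ring.
  + apply Ccont_mult. apply Ccont_pow, Ccont_circ_inv. now apply Ccont_on_circle.
- intros t. transitivity (circ_inv r t ^ n * (- Ci * on_circle u v r t))%C; [|ring].
  f_equal. apply injective_projections; simpl; ring.
Qed.

Lemma RtoC_Re_mult x n (z : C) : Re (RtoC x ^ n * z)%C = x ^ n * Re z.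
Proof. rewrite <- RtoC_pow. unfold Re; simpl; ring. Qed.

Lemma RtoC_Im_mult x n (z : C) : Im (RtoC x ^ n * z)%C = x ^ n * Im z.
Proof. rewrite <- RtoC_pow. unfold Im; simpl; ring. Qed.

(** Uniqueness of the coefficients, from values on a real interval around 0. It serves to compare
    circles of different radii, to compare slices, and to exploit a product series that sums to
    0. *)
Lemma is_pseries_coef (a : nat -> R) (phi : R -> R) (r : R) : 0 < r ->
  (forall x, Rabs x < r -> is_series (fun n => x ^ n * a n) (phi x)) ->
  forall n, a n = Derive_n phi n 0 / INR (Factorial.fact n).
Proof.
intros Hr H n.
assert (Hrad : Rbar_lt 0 (CV_radius a)).
{ apply Rbar_lt_le_trans with (Finite (r / 2)); [simpl; lra|].
  rewrite <- (Rabs_pos_eq (r / 2)) by lra.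
  apply Rbar_not_lt_le; intros L.
  apply (CV_disk_outside a (r / 2) L).
  assert (S : ex_series (fun n => a n * (r / 2) ^ n)).
  { exists (phi (r / 2)). eapply is_series_ext; [|apply H; rewrite Rabs_pos_eq; lra].
    intros; simpl; ring. }
  apply ex_series_lim_0 in S. exact S. }
rewrite (Derive_n_ext_loc phi (PSeries a) n 0).
- rewrite Derive_n_coef; auto. field. apply INR_fact_neq_0.
- exists (mkposreal r Hr). intros y Hy.
  assert (Hy' : Rabs (y + - 0) < r) by exact Hy. rewrite Ropp_0, Rplus_0_r in Hy'.
  symmetry. unfold PSeries. apply is_series_unique.
  eapply is_series_ext; [|apply H; exact Hy'].
  intros; apply Rmult_comm.
Qed.

(** The expansion over the circle of radius r holds only for |w| < r, and its coefficients seem to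
    depend on r. Being given by derivatives at 0 along the real axis, they do not, so each w may use
    its own radius |w| + 1. *)
Lemma entire_expansion (u v ux uy : R -> R -> R) :
  conjugate_pair u v ux uy ->
  exists c : nat -> C, forall w : C,
    is_series (fun n => Re (w ^ n * c n)%C) (u (Re w) (Im w)) /\
    is_series (fun n => Im (w ^ n * c n)%C) (v (Re w) (Im w)).
Proof.
intros H.
assert (Cu : forall x y, continuity_2d_pt u x y) by (intros x y; apply (proj1 (conjugate_pair_continuous _ _ _ _ H x y))).
assert (Cv : forall x y, continuity_2d_pt v x y) by (intros x y; apply (proj2 (conjugate_pair_continuous _ _ _ _ H x y))).
assert (L : forall r w, 0 < r -> Cmod w < r ->
    is_series (fun n => Re (w ^ n * circle_coef u v r n)%C) (u (Re w) (Im w)) /\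
    is_series (fun n => Im (w ^ n * circle_coef u v r n)%C) (v (Re w) (Im w))).
{ intros r w Hr Hw; split; [now apply (cauchy_formula u v ux uy)|].
  eapply is_series_ext; [|apply (cauchy_formula _ _ _ _ r w (conjugate_pair_rotate _ _ _ _ H) Hr Hw)].
  intros n; cbv beta; rewrite circle_coef_rotate by assumption. unfold Re, Im; simpl; ring. }
exists (fun n => (Derive_n (fun x => u x 0) n 0 / INR (Factorial.fact n), Derive_n (fun x => v x 0) n 0 / INR (Factorial.fact n))).
assert (K : forall r n, 0 < r -> circle_coef u v r n =
  (Derive_n (fun x => u x 0) n 0 / INR (Factorial.fact n), Derive_n (fun x => v x 0) n 0 / INR (Factorial.fact n))).
{ intros r n Hr.
  apply injective_projections; simpl.
  - apply (is_pseries_coef (fun n => Re (circle_coef u v r n)) _ r Hr).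
    intros x Hx. eapply is_series_ext; [|apply (L r (RtoC x) Hr); now rewrite Cmod_R].
    intros; apply RtoC_Re_mult.
  - apply (is_pseries_coef (fun n => Im (circle_coef u v r n)) _ r Hr).
    intros x Hx. eapply is_series_ext; [|apply (L r (RtoC x) Hr); now rewrite Cmod_R].
    intros; apply RtoC_Im_mult. }
intros w.
assert (Hw : 0 < Cmod w + 1) by (assert (P := Cmod_ge_0 w); lra).
destruct (L (Cmod w + 1) w Hw) as [L1 L2]; [lra|].
split.
- eapply is_series_ext; [|exact L1]. intros n; cbv beta. now rewrite (K _ n Hw).
- eapply is_series_ext; [|exact L2]. intros n; cbv beta. now rewrite (K _ n Hw).
Qed.

(** * Series of functions dominated by a convergent numerical series *)

Lemma ex_series_Rle (a M : nat -> R) : (forall n, Rabs (a n) <= M n) -> ex_series M -> ex_series a.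
Proof. apply (ex_series_le (V := R_CompleteNormedModule)). Qed.

Lemma Rabs_Series_le (a M : nat -> R) :
  (forall n, Rabs (a n) <= M n) -> ex_series M -> Rabs (Series a) <= Series M.
Proof.
intros H HM.
eapply Rle_trans; [apply Series_Rabs|].
- eapply ex_series_Rle; [|exact HM]. intros; now rewrite Rabs_Rabsolu.
- apply Series_le; auto. intros; split; auto. apply Rabs_pos.
Qed.

(** The rank [N0] is found before [a] is given, because the tail of [M] bounds that of every
    dominated series. Continuity and differentiation of a sum rest on this uniformity. *)
Lemma series_tail_unif (M : nat -> R) : ex_series M -> forall eps : posreal,
  exists N0, forall N, (N0 <= N)%nat -> forall a : nat -> R, (forall n, Rabs (a n) <= M n) ->
    Rabs (sum_n a N - Series a) < eps.
Proof.
intros HM eps.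
assert (L := Series_correct _ HM). change (is_lim_seq (sum_n M) (Series M)) in L.
apply is_lim_seq_spec in L. destruct (L eps) as [N0 HN].
exists N0; intros N HN0 a Ha.
specialize (HN N HN0).
assert (Sa := ex_series_Rle a M Ha HM).
assert (E : forall b, ex_series b -> Series b - sum_n b N = Series (fun k => b (S N + k)%nat)).
{ intros b Hb. rewrite (Series_incr_n b (S N)) by (auto; lia).
  simpl pred. rewrite sum_n_Reals. apply Rplus_minus_l. }
rewrite Rabs_minus_sym, E by auto.
rewrite Rabs_minus_sym, E in HN by auto.
apply Rle_lt_trans with (2 := HN).
eapply Rle_trans; [apply Rabs_Series_le with (M := fun k => M (S N + k)%nat)|].
- intros; apply Ha.
- now apply (ex_series_incr_n M (S N)).
- apply Rle_abs.
Qed.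

Lemma sum_n_continuous {T : UniformSpace} (f : nat -> T -> R) (x : T) N :
  (forall n, continuous (f n) x) -> continuous (fun t => sum_n (fun n => f n t) N) x.
Proof.
intros H; induction N as [|N IH].
- apply continuous_ext with (f 0%nat); [|apply H]. intros; now rewrite sum_O.
- apply continuous_ext with (fun t => sum_n (fun n => f n t) N + f (S N) t).
  + intros; now rewrite sum_Sn.
  + apply (continuous_plus (V := R_NormedModule)); auto.
Qed.

Lemma series_continuous {T : UniformSpace} (f : nat -> T -> R) (M : nat -> R) (x : T) :
  (forall n, continuous (f n) x) -> ex_series M ->
  locally x (fun y => forall n, Rabs (f n y) <= M n) ->
  continuous (fun t => Series (fun n => f n t)) x.
Proof.
intros Cf HM HB.
apply filterlim_locally. intros eps.
destruct (series_tail_unif M HM (mkposreal (eps / 3) ltac:(destruct eps; simpl; lra))) as [N HN].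
specialize (HN N (Nat.le_refl N)); simpl in HN.
assert (C := sum_n_continuous f x N Cf).
apply filterlim_locally with (eps := mkposreal (eps / 3) ltac:(destruct eps; simpl; lra)) in C.
assert (Hx := locally_singleton _ _ HB).
generalize (filter_and _ _ C HB). apply filter_imp. intros y [H1 H2].
apply HN in H2. apply HN in Hx.
assert (H1' : Rabs (sum_n (fun n => f n y) N - sum_n (fun n => f n x) N) < eps / 3) by exact H1.
change (Rabs (Series (fun n => f n y) - Series (fun n => f n x)) < eps).
apply Rabs_def2 in H1'; apply Rabs_def2 in H2; apply Rabs_def2 in Hx.
apply Rabs_def1; lra.
Qed.

(** A derivative at 0 is enough since t will be a displacement along a line; |t| < 1 is the open set
    on which [CVU_Derive] wants uniform convergence of the partial sums and of their derivatives. *)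
Lemma series_derive (f df : nat -> R -> R) (M M' : nat -> R) :
  (forall n t, is_derive (f n) t (df n t)) -> (forall n t, continuous (df n) t) ->
  ex_series M -> ex_series M' ->
  (forall n t, Rabs t < 1 -> Rabs (f n t) <= M n) ->
  (forall n t, Rabs t < 1 -> Rabs (df n t) <= M' n) ->
  is_derive (fun t => Series (fun n => f n t)) 0 (Series (fun n => df n 0)).
Proof.
intros Hd Hc HM HM' Hf Hdf.
set (D := fun t => -1 < t < 1).
assert (HD : forall t, D t -> Rabs t < 1) by (intros t [A B]; apply Rabs_def1; lra).
assert (Ed : forall N t, is_derive (fun y => sum_n (fun n => f n y) N) t (sum_n (fun n => df n t) N)).
{ intros; apply (is_derive_sum_n (V := R_NormedModule) f); auto. }
assert (DE : forall N (t : R), Derive (fun y : R => sum_n (fun n => f n y) N) t = sum_n (fun n => df n t) N)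
  by (intros; apply is_derive_unique, Ed).
assert (H := CVU_Derive (fun N t => sum_n (fun n => f n t) N) D).
assert (H0 : is_derive (fun y => real (Lim_seq (fun N => sum_n (fun n => f n y) N))) 0
   (real (Lim_seq (fun N => Derive (fun t => sum_n (fun n => f n t) N) 0)))).
{ apply H.
  - apply open_and; [apply open_gt|apply open_lt].
  - intros a b x Ha Hb Hx. unfold D in *; lra.
  - intros eps. destruct (series_tail_unif M HM eps) as [N HN]. exists N; intros n Hn x Hx.
    apply (HN n Hn (fun k => f k x)). intros; auto.
  - intros; eexists; apply Ed.
  - intros n x Hx. apply continuity_pt_filterlim.
    apply (continuous_ext (fun t => sum_n (fun k => df k t) n)).
    + intros; symmetry; apply DE.
    + apply sum_n_continuous; auto.
  - intros eps. destruct (series_tail_unif M' HM' eps) as [N HN]. exists N; intros n Hn x Hx.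
    rewrite DE.
    rewrite (Lim_seq_ext _ (fun n => sum_n (fun k => df k x) n)).
    + apply (HN n Hn (fun k => df k x)). intros; auto.
    + intros; apply DE.
  - unfold D; lra. }
rewrite (Lim_seq_ext _ (fun N => sum_n (fun k => df k 0) N)) in H0.
- exact H0.
- intros; apply DE.
Qed.

(** * Quaternions *)

(** The l1 norm on R^4. It bounds every coordinate and is submultiplicative, because a product of
    two basis units is a basis unit up to sign. *)
Definition qnorm (q : quat) : R := Rabs (q0 q) + Rabs (q1 q) + Rabs (q2 q) + Rabs (q3 q).

Lemma qnorm_ge0 q : 0 <= qnorm q.
Proof.
unfold qnorm. assert (A := Rabs_pos (q0 q)); assert (B := Rabs_pos (q1 q));
assert (C := Rabs_pos (q2 q)); assert (D := Rabs_pos (q3 q)); lra.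
Qed.

Lemma qnorm_comp q : Rabs (q0 q) <= qnorm q /\ Rabs (q1 q) <= qnorm q /\
  Rabs (q2 q) <= qnorm q /\ Rabs (q3 q) <= qnorm q.
Proof.
unfold qnorm. assert (A := Rabs_pos (q0 q)); assert (B := Rabs_pos (q1 q));
assert (C := Rabs_pos (q2 q)); assert (D := Rabs_pos (q3 q)); lra.
Qed.

Lemma qnorm_plus p q : qnorm (plus p q) <= qnorm p + qnorm q.
Proof.
unfold qnorm.
assert (A := Rabs_triang (q0 p) (q0 q)); assert (B := Rabs_triang (q1 p) (q1 q));
assert (C := Rabs_triang (q2 p) (q2 q)); assert (D := Rabs_triang (q3 p) (q3 q)).
change (Rabs (q0 p + q0 q) + Rabs (q1 p + q1 q) + Rabs (q2 p + q2 q) + Rabs (q3 p + q3 q) <=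
  Rabs (q0 p) + Rabs (q1 p) + Rabs (q2 p) + Rabs (q3 p) +
  (Rabs (q0 q) + Rabs (q1 q) + Rabs (q2 q) + Rabs (q3 q))). lra.
Qed.

Lemma qnorm_scal (t : R) (q : quat) : qnorm (scal t q) = Rabs t * qnorm q.
Proof.
change (Rabs (t * q0 q) + Rabs (t * q1 q) + Rabs (t * q2 q) + Rabs (t * q3 q) = Rabs t * qnorm q).
rewrite !Rabs_mult. unfold qnorm; ring.
Qed.

Lemma qnorm_mult (p q : quat) : qnorm (mult p q) <= qnorm p * qnorm q.
Proof.
change (qnorm (qmult p q) <= qnorm p * qnorm q).
assert (T : forall a b c d a' b' c' d', Rabs (a * a' - b * b' - c * c' - d * d') <=
   Rabs a * Rabs a' + Rabs b * Rabs b' + Rabs c * Rabs c' + Rabs d * Rabs d').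
{ intros. unfold Rminus.
  rewrite <- !Rabs_mult, <- (Rabs_Ropp (b * b')), <- (Rabs_Ropp (c * c')), <- (Rabs_Ropp (d * d')).
  eapply Rle_trans; [apply Rabs_triang|]; apply Rplus_le_compat_r.
  eapply Rle_trans; [apply Rabs_triang|]; apply Rplus_le_compat_r. apply Rabs_triang. }
unfold qnorm, qmult, mkquat, q0, q1, q2, q3; simpl.
destruct p as [[[a b] c] d]; destruct q as [[[a' b'] c'] d']; simpl.
assert (H0 := T a b c d a' b' c' d').
(* The other three coordinates of the product have the shape of [T] once signs are moved into the
   second factor. *)
assert (H1 := T a b c d b' (- a') (- d') c').
assert (H2 := T a b c d c' d' (- a') (- b')).
assert (H3 := T a b c d d' (- c') b' (- a')).
rewrite ?Rabs_Ropp in *.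
replace (a * b' - b * - a' - c * - d' - d * c') with (a * b' + b * a' + c * d' - d * c') in H1 by ring.
replace (a * c' - b * d' - c * - a' - d * - b') with (a * c' - b * d' + c * a' + d * b') in H2 by ring.
replace (a * d' - b * - c' - c * b' - d * - a') with (a * d' + b * c' - c * b' + d * a') in H3 by ring.
lra.
Qed.

Lemma continuous_pair_map {T U V : UniformSpace} (f : T -> U) (g : T -> V) (x : T) :
  continuous f x -> continuous g x -> continuous (fun t => (f t, g t)) x.
Proof.
intros Hf Hg. apply (filterlim_locally (U := prod_UniformSpace U V)). intros eps.
assert (A := proj1 (filterlim_locally _ _) Hf eps).
assert (B := proj1 (filterlim_locally _ _) Hg eps).
generalize (filter_and _ _ A B). apply filter_imp. intros y [H1 H2]; split; assumption.
Qed.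

Lemma continuous_quat {T : UniformSpace} (f : T -> quat) (x : T) :
  continuous f x <->
  continuous (fun t => q0 (f t)) x /\ continuous (fun t => q1 (f t)) x /\
  continuous (fun t => q2 (f t)) x /\ continuous (fun t => q3 (f t)) x.
Proof.
split.
- intros H.
  assert (P1 : continuous (fun t => fst (f t)) x) by
    (apply (continuous_comp f (fun q => fst q) x H); apply continuous_fst).
  assert (P2 : continuous (fun t => fst (fst (f t))) x) by
    (apply (continuous_comp _ (fun q => fst q) x P1); apply continuous_fst).
  repeat split.
  + apply (continuous_comp _ (fun q => fst q) x P2); apply continuous_fst.
  + apply (continuous_comp _ (fun q => snd q) x P2); apply continuous_snd.
  + apply (continuous_comp _ (fun q => snd q) x P1); apply continuous_snd.
  + apply (continuous_comp _ (fun q => snd q) x H); apply continuous_snd.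
- intros (H0 & H1 & H2 & H3).
  apply (continuous_ext (fun t => (q0 (f t), q1 (f t), q2 (f t), q3 (f t)) : quat_UniformSpace)).
  + intros t; destruct (f t) as [[[a b] c] d]; reflexivity.
  + apply continuous_pair_map; [apply continuous_pair_map; [apply continuous_pair_map|]|]; assumption.
Qed.

(** * Derivatives of quaternion-valued curves *)

(** It connects [class_C], which requires [ex_derive] in H, with [dir_derive] and [dbar], which are
    built from [Derive] of the coordinates and are meaningful only where these derivatives exist. *)
Definition qderive (phi : R -> quat) (t : R) (l : quat) : Prop :=
  is_derive (fun s => q0 (phi s)) t (q0 l) /\ is_derive (fun s => q1 (phi s)) t (q1 l) /\
  is_derive (fun s => q2 (phi s)) t (q2 l) /\ is_derive (fun s => q3 (phi s)) t (q3 l).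

Lemma is_derive_pair {U V : NormedModule R_AbsRing} (f : R -> U) (g : R -> V) (t : R) (l : U) (m : V) :
  is_derive f t l -> is_derive g t m ->
  is_derive (V := prod_NormedModule R_AbsRing U V) (fun s => (f s, g s)) t (l, m).
Proof.
intros Hf Hg.
apply (filterdiff_comp'_2 (W := prod_NormedModule R_AbsRing U V) f g (fun u v => (u, v)) t _ _ (fun u v => (u, v)) Hf Hg).
apply filterdiff_ext_lin with (fun z => z).
- apply filterdiff_ext with (fun z => z); [now intros [a b]|]. apply filterdiff_id.
- now intros [a b].
Qed.

Lemma qderive_is_derive phi t l : qderive phi t l -> is_derive phi t l.
Proof.
intros (H0 & H1 & H2 & H3).
apply (is_derive_ext (fun s => (q0 (phi s), q1 (phi s), q2 (phi s), q3 (phi s)) : quat_NormedModule)).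
- intros s; destruct (phi s) as [[[a b] c] d]; reflexivity.
- replace l with ((q0 l, q1 l, q2 l, q3 l) : quat) by (destruct l as [[[a b] c] d]; reflexivity).
  exact (is_derive_pair _ _ t _ _ (is_derive_pair _ _ t _ _ (is_derive_pair _ _ t _ _ H0 H1) H2) H3).
Qed.

Lemma is_derive_qderive phi t l : is_derive phi t l -> qderive phi t l.
Proof.
intros H.
assert (F : forall (U V : NormedModule R_AbsRing) (f : R -> prod_NormedModule R_AbsRing U V) l',
   is_derive f t l' -> is_derive (fun s => fst (f s)) t (fst l') /\ is_derive (fun s => snd (f s)) t (snd l')).
{ intros U V f l' Hf; split.
  - apply (filterdiff_comp' f (fun z => fst z) t _ (fun z => fst z) Hf). apply filterdiff_linear, is_linear_fst.
  - apply (filterdiff_comp' f (fun z => snd z) t _ (fun z => snd z) Hf). apply filterdiff_linear, is_linear_snd. }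
destruct (F _ _ _ _ H) as [A D]. destruct (F _ _ _ _ A) as [B C]. destruct (F _ _ _ _ B) as [E G].
exact (conj E (conj G (conj C D))).
Qed.

Lemma qderive_ex phi t l : qderive phi t l -> ex_derive phi t.
Proof. intros H; exists l. now apply qderive_is_derive. Qed.

Lemma qderive_unique phi t l : qderive phi t l -> curve_derive phi t = l.
Proof.
intros (H0 & H1 & H2 & H3); apply quat_eq; now apply is_derive_unique.
Qed.

Lemma ex_derive_qderive (phi : R -> quat) t : ex_derive phi t -> qderive phi t (curve_derive phi t).
Proof.
intros [l H]. apply is_derive_qderive in H. now rewrite (qderive_unique _ _ _ H).
Qed.

Lemma qderive_const a t : qderive (fun _ => a) t zero.
Proof. refine (conj _ (conj _ (conj _ _))); apply (is_derive_const (V := R_NormedModule)). Qed.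

Lemma qderive_plus phi psi t l m : qderive phi t l -> qderive psi t m ->
  qderive (fun s => plus (phi s) (psi s)) t (plus l m).
Proof.
intros (H0 & H1 & H2 & H3) (K0 & K1 & K2 & K3).
refine (conj _ (conj _ (conj _ _))); apply (is_derive_plus (V := R_NormedModule)); assumption.
Qed.

Lemma is_derive_Rmult (f g : R -> R) t l m : is_derive f t l -> is_derive g t m ->
  is_derive (fun s => f s * g s) t (l * g t + f t * m).
Proof. intros Hf Hg. apply (is_derive_mult f g t l m Hf Hg). apply Rmult_comm. Qed.

Lemma qderive_mult phi psi t l m : qderive phi t l -> qderive psi t m ->
  qderive (fun s => mult (phi s) (psi s)) t (plus (mult l (psi t)) (mult (phi t) m)).
Proof.
intros (H0 & H1 & H2 & H3) (K0 & K1 & K2 & K3).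
assert (M := is_derive_minus (V := R_NormedModule) (K := R_AbsRing)).
assert (P := is_derive_plus (V := R_NormedModule) (K := R_AbsRing)).
pose (L := @is_derive_Rmult).
refine (conj _ (conj _ (conj _ _))).
- assert (X := M _ _ _ _ _ (M _ _ _ _ _ (M _ _ _ _ _ (L _ _ _ _ _ H0 K0) (L _ _ _ _ _ H1 K1)) (L _ _ _ _ _ H2 K2)) (L _ _ _ _ _ H3 K3)).
  eapply eq_rect; [exact X|]. unfold minus, plus, opp, mult; simpl; unfold qmult, mkquat, q0, q1, q2, q3; simpl; unfold plus; simpl. ring.
- assert (X := M _ _ _ _ _ (P _ _ _ _ _ (P _ _ _ _ _ (L _ _ _ _ _ H0 K1) (L _ _ _ _ _ H1 K0)) (L _ _ _ _ _ H2 K3)) (L _ _ _ _ _ H3 K2)).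
  eapply eq_rect; [exact X|]. unfold minus, plus, opp, mult; simpl; unfold qmult, mkquat, q0, q1, q2, q3; simpl; unfold plus; simpl. ring.
- assert (X := P _ _ _ _ _ (P _ _ _ _ _ (M _ _ _ _ _ (L _ _ _ _ _ H0 K2) (L _ _ _ _ _ H1 K3)) (L _ _ _ _ _ H2 K0)) (L _ _ _ _ _ H3 K1)).
  eapply eq_rect; [exact X|]. unfold minus, plus, opp, mult; simpl; unfold qmult, mkquat, q0, q1, q2, q3; simpl; unfold plus; simpl. ring.
- assert (X := P _ _ _ _ _ (M _ _ _ _ _ (P _ _ _ _ _ (L _ _ _ _ _ H0 K3) (L _ _ _ _ _ H1 K2)) (L _ _ _ _ _ H2 K1)) (L _ _ _ _ _ H3 K0)).
  eapply eq_rect; [exact X|]. unfold minus, plus, opp, mult; simpl; unfold qmult, mkquat, q0, q1, q2, q3; simpl; unfold plus; simpl. ring.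
Qed.

Lemma qderive_line p v t : qderive (fun s => plus p (scal s v)) t v.
Proof.
assert (A : forall a b : R, is_derive (fun s => a + s * b) t b) by (intros; auto_derive; auto; ring).
refine (conj _ (conj _ (conj _ _))); apply A.
Qed.

Lemma qderive_ext phi psi t l : (forall s, phi s = psi s) -> qderive phi t l -> qderive psi t l.
Proof. intros E. replace psi with phi; [auto|]. now apply functional_extensionality. Qed.

Lemma qderive_shift phi t l : qderive (fun s => phi (t + s)) 0 l -> qderive phi t l.
Proof.
assert (S : forall (f : R -> R) m, is_derive (fun s => f (t + s)) 0 m -> is_derive f t m).
{ intros f m H.
  apply (is_derive_ext (fun s => f (t + (s - t)))); [intros; f_equal; ring|].
  assert (B : is_derive (fun s : R => s - t) t 1) by (auto_derive; auto; ring).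
  replace m with (scal 1 m) by apply Rmult_1_l.
  apply (is_derive_comp (fun s => f (t + s)) (fun s => s - t) t m 1).
  - now replace (t - t) with 0 by ring.
  - exact B. }
intros (H0 & H1 & H2 & H3). refine (conj _ (conj _ (conj _ _))); now apply S.
Qed.

(** [class_C] asks for differentiability at parameter 0 of the line through each point; taking q + t
    v as base point turns this into a derivative at every t. *)
Lemma dir_derive_qderive f v q t :
  (forall p : quat, ex_derive (fun s : R => f (plus p (scal s v))) 0) ->
  qderive (fun s => f (plus q (scal s v))) t (dir_derive f v (plus q (scal t v))).
Proof.
intros H. apply qderive_shift.
assert (E := ex_derive_qderive _ _ (H (plus q (scal t v)))).
revert E. apply qderive_ext. intros s. f_equal.
etransitivity; [symmetry; apply plus_assoc|]. apply f_equal. symmetry. exact (scal_distr_r t s v).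
Qed.

Lemma dir_derive_eq f v q l : qderive (fun s => f (plus q (scal s v))) 0 l -> dir_derive f v q = l.
Proof. apply qderive_unique. Qed.

(* The majorant is shifted by 1 and multiplied by [qnorm v] at each derivative, in the
   manner of Cauchy's estimates, so that summability for all r is stable. *)
Fixpoint majorized (k : nat) (h : quat -> quat) (m : R -> R) : Prop :=
  (forall q, continuous h q) /\ (forall q r, qnorm q <= r -> qnorm (h q) <= m r) /\
  match k with
  | O => True
  | S k' => forall v : quat,
      (forall q : quat, ex_derive (fun t : R => h (plus q (scal t v))) 0) /\
      majorized k' (dir_derive h v) (fun r => qnorm v * m (r + 1))
  end.

Lemma majorized_continuous k h m : majorized k h m -> forall q, continuous h q.
Proof. destruct k; intros H; apply H. Qed.

Lemma majorized_bound k h m : majorized k h m -> forall q r, qnorm q <= r -> qnorm (h q) <= m r.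
Proof. destruct k; intros H; apply H. Qed.

(** * Series of quaternionic functions and their smoothness *)

Definition quat_series (T : nat -> quat -> quat) (q : quat) : quat :=
  mkquat (Series (fun n => q0 (T n q))) (Series (fun n => q1 (T n q)))
         (Series (fun n => q2 (T n q))) (Series (fun n => q3 (T n q))).

(** In the unit ball of the product space each of the four coordinates moves by less than 1, whence
    the 4. *)
Lemma qnorm_locally (q : quat) : locally q (fun p => qnorm p <= qnorm q + 4).
Proof.
exists (mkposreal 1 Rlt_0_1). intros p [[[H0 H1] H2] H3].
assert (A : forall a b, Rabs (b - a) < 1 -> Rabs b <= Rabs a + 1).
{ intros a b H. replace b with (a + (b - a)) by ring. eapply Rle_trans; [apply Rabs_triang|]. lra. }
unfold qnorm, q0, q1, q2, q3.
apply A in H0; apply A in H1; apply A in H2; apply A in H3. simpl in *. lra.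
Qed.

Lemma qnorm_line (q v : quat) (t : R) : Rabs t < 1 -> qnorm (plus q (scal t v)) <= qnorm q + qnorm v.
Proof.
intros Ht. eapply Rle_trans; [apply qnorm_plus|]. rewrite qnorm_scal.
assert (P := qnorm_ge0 v). apply Rplus_le_compat_l. rewrite <- (Rmult_1_l (qnorm v)) at 2.
apply Rmult_le_compat_r; lra.
Qed.

Lemma line_0 (q v : quat) : plus q (scal 0 v) = q.
Proof. etransitivity; [apply f_equal; exact (scal_zero_l v)|apply plus_zero_r]. Qed.

Lemma line_continuous (q v : quat) t : continuous (fun s : R => plus q (scal s v)) t.
Proof. apply (ex_derive_continuous (V := quat_NormedModule)). exact (qderive_ex _ _ _ (qderive_line q v t)). Qed.

(** For |t| < 1 the line stays in the ball of radius |q| + |v|, so the majorants at that radius, and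
    at that radius plus 1 for the derivatives, dominate uniformly in t. *)
Lemma quat_series_qderive k (T : nat -> quat -> quat) (m : nat -> R -> R) (v q : quat) :
  (forall n, majorized (S k) (T n) (m n)) -> (forall r, 0 <= r -> ex_series (fun n => m n r)) ->
  qderive (fun t => quat_series T (plus q (scal t v))) 0 (quat_series (fun n => dir_derive (T n) v) q).
Proof.
intros HT Hm.
assert (Pq := qnorm_ge0 q). assert (Pv := qnorm_ge0 v).
assert (Q : forall n t, qderive (fun s => T n (plus q (scal s v))) t
   (dir_derive (T n) v (plus q (scal t v)))).
{ intros n t. apply dir_derive_qderive. apply (proj2 (proj2 (HT n)) v). }
assert (HD : forall n, majorized k (dir_derive (T n) v) (fun r => qnorm v * m n (r + 1))).
{ intros n. apply (proj2 (proj2 (HT n)) v). }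
assert (Cd : forall n (t : R), continuous (fun s : R => dir_derive (T n) v (plus q (scal s v))) t).
{ intros n t. apply (continuous_comp (fun s : R => plus q (scal s v)) (dir_derive (T n) v)).
  apply line_continuous. eapply majorized_continuous, HD. }
assert (HM : ex_series (fun n => m n (qnorm q + qnorm v))) by (apply Hm; lra).
assert (HM' : ex_series (fun n => qnorm v * m n (qnorm q + qnorm v + 1))).
{ apply (ex_series_scal_l (qnorm v) (fun n => m n (qnorm q + qnorm v + 1))). apply Hm; lra. }
assert (B : forall n t, Rabs t < 1 -> qnorm (T n (plus q (scal t v))) <= m n (qnorm q + qnorm v)).
{ intros n t Ht. apply (majorized_bound _ _ _ (HT n)). now apply qnorm_line. }
assert (B' : forall n t, Rabs t < 1 -> qnorm (dir_derive (T n) v (plus q (scal t v))) <=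
   qnorm v * m n (qnorm q + qnorm v + 1)).
{ intros n t Ht. apply (majorized_bound _ _ _ (HD n)). now apply qnorm_line. }
assert (E : quat_series (fun n => dir_derive (T n) v) q =
  quat_series (fun n => dir_derive (T n) v) (plus q (scal 0 v))) by now rewrite line_0.
rewrite E.
assert (S : forall c : quat -> R, (forall p, Rabs (c p) <= qnorm p) ->
  (forall n (t : R), is_derive (fun s : R => c (T n (plus q (scal s v)))) t
     (c (dir_derive (T n) v (plus q (scal t v))))) ->
  (forall n (t : R), continuous (fun s : R => c (dir_derive (T n) v (plus q (scal s v)))) t) ->
  is_derive (fun s : R => Series (fun n => c (T n (plus q (scal s v))))) 0
     (Series (fun n => c (dir_derive (T n) v (plus q (scal 0 v)))))).
{ intros c Hc Dc Cc.
  apply (series_derive (fun n t => c (T n (plus q (scal t v))))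
     (fun n t => c (dir_derive (T n) v (plus q (scal t v)))) _ _ Dc Cc HM HM');
  intros n t Ht; (eapply Rle_trans; [apply Hc|]); auto. }
refine (conj _ (conj _ (conj _ _))).
- exact (S q0 (fun p => proj1 (qnorm_comp p)) (fun n t => proj1 (Q n t)) (fun n t => proj1 (proj1 (continuous_quat _ t) (Cd n t)))).
- exact (S q1 (fun p => proj1 (proj2 (qnorm_comp p))) (fun n t => proj1 (proj2 (Q n t))) (fun n t => proj1 (proj2 (proj1 (continuous_quat _ t) (Cd n t))))).
- exact (S q2 (fun p => proj1 (proj2 (proj2 (qnorm_comp p)))) (fun n t => proj1 (proj2 (proj2 (Q n t)))) (fun n t => proj1 (proj2 (proj2 (proj1 (continuous_quat _ t) (Cd n t)))))).
- exact (S q3 (fun p => proj2 (proj2 (proj2 (qnorm_comp p)))) (fun n t => proj2 (proj2 (proj2 (Q n t)))) (fun n t => proj2 (proj2 (proj2 (proj1 (continuous_quat _ t) (Cd n t)))))).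
Qed.

Lemma quat_series_class_C k : forall (T : nat -> quat -> quat) (m : nat -> R -> R),
  (forall n, majorized k (T n) (m n)) -> (forall r, 0 <= r -> ex_series (fun n => m n r)) ->
  class_C k (quat_series T).
Proof.
induction k as [|k IH]; intros T m HT Hm.
- intros q.
  assert (C : forall n, continuous (T n) q) by (intros n; now apply (majorized_continuous 0 _ (m n))).
  assert (P := qnorm_ge0 q).
  assert (S : forall c : quat -> R, (forall p, Rabs (c p) <= qnorm p) ->
    (forall n, continuous (fun p => c (T n p)) q) ->
    continuous (fun p => Series (fun n => c (T n p))) q).
  { intros c Hc Cc. apply series_continuous with (fun n => m n (qnorm q + 4)); [exact Cc|apply Hm; lra|].
    generalize (qnorm_locally q); apply filter_imp; intros p Hp n.
    eapply Rle_trans; [apply Hc|]. now apply (majorized_bound 0 _ (m n)). }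
  apply continuous_quat. refine (conj _ (conj _ (conj _ _))); apply S; intros; try apply qnorm_comp;
    apply (proj1 (continuous_quat (T n) q)), C.
- intros v.
  assert (D := fun q => quat_series_qderive k T m v q HT Hm).
  split.
  + intros q. eapply qderive_ex, D.
  + replace (dir_derive (quat_series T) v) with (quat_series (fun n => dir_derive (T n) v)).
    2:{ apply functional_extensionality; intros q. symmetry. apply dir_derive_eq, D. }
    apply IH with (fun n r => qnorm v * m n (r + 1)).
    * intros n. apply (proj2 (proj2 (HT n)) v).
    * intros r Hr. apply (ex_series_scal_l (qnorm v) (fun n => m n (r + 1))). apply Hm; lra.
Qed.

Lemma majorized_le k : forall h m m', (forall r, 0 <= r -> m r <= m' r) ->
  majorized k h m -> majorized k h m'.
Proof.
induction k as [|k IH]; intros h m m' L (H1 & H2 & H3); (split; [exact H1|split]).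
- intros q r Hr. eapply Rle_trans; [apply (H2 q r Hr)|]. apply L. assert (P := qnorm_ge0 q); lra.
- exact H3.
- intros q r Hr. eapply Rle_trans; [apply (H2 q r Hr)|]. apply L. assert (P := qnorm_ge0 q); lra.
- intros v. destruct (H3 v) as [A B]; split; [exact A|].
  apply IH with (2 := B). intros r Hr. apply Rmult_le_compat_l; [apply qnorm_ge0|apply L; lra].
Qed.

Lemma majorized_pred k : forall h m, majorized (S k) h m -> majorized k h m.
Proof.
induction k as [|k IH]; intros h m (H1 & H2 & H3); (split; [exact H1|split; [exact H2|]]).
- exact I.
- intros v. destruct (H3 v) as [A B]; split; [exact A|]. now apply IH.
Qed.

Lemma qnorm_zero : qnorm zero = 0.
Proof. change (Rabs 0 + Rabs 0 + Rabs 0 + Rabs 0 = 0). rewrite Rabs_R0; ring. Qed.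

Lemma majorized_const k : forall a, majorized k (fun _ => a) (fun _ => qnorm a).
Proof.
induction k as [|k IH]; intros a;
  (split; [intros; apply continuous_const|split; [intros; apply Rle_refl|]]).
- exact I.
- intros v. split; [intros; eapply qderive_ex, qderive_const|].
  replace (dir_derive (fun _ => a) v) with (fun _ : quat => zero : quat).
  2:{ apply functional_extensionality; intros; symmetry; apply dir_derive_eq, qderive_const. }
  apply majorized_le with (2 := IH zero). intros r Hr. rewrite qnorm_zero.
  apply Rmult_le_pos; apply qnorm_ge0.
Qed.

Lemma continuous_qmult {T : UniformSpace} (f g : T -> quat) x :
  continuous f x -> continuous g x -> continuous (fun t => mult (f t) (g t)) x.
Proof.
intros Hf Hg.
apply continuous_quat in Hf; apply continuous_quat in Hg.
destruct Hf as (A0 & A1 & A2 & A3); destruct Hg as (B0 & B1 & B2 & B3).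
apply continuous_quat. refine (conj _ (conj _ (conj _ _))).
- change (continuous (fun t => q0 (f t) * q0 (g t) - q1 (f t) * q1 (g t) - q2 (f t) * q2 (g t) - q3 (f t) * q3 (g t)) x). cont.
- change (continuous (fun t => q0 (f t) * q1 (g t) + q1 (f t) * q0 (g t) + q2 (f t) * q3 (g t) - q3 (f t) * q2 (g t)) x). cont.
- change (continuous (fun t => q0 (f t) * q2 (g t) - q1 (f t) * q3 (g t) + q2 (f t) * q0 (g t) + q3 (f t) * q1 (g t)) x). cont.
- change (continuous (fun t => q0 (f t) * q3 (g t) + q1 (f t) * q2 (g t) - q2 (f t) * q1 (g t) + q3 (f t) * q0 (g t)) x). cont.
Qed.

Lemma continuous_qplus {T : UniformSpace} (f g : T -> quat) x :
  continuous f x -> continuous g x -> continuous (fun t => plus (f t) (g t)) x.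
Proof. apply (continuous_plus (V := quat_NormedModule)). Qed.

Lemma dir_derive_plus (f g : quat -> quat) (v : quat) :
  (forall q : quat, ex_derive (fun t : R => f (plus q (scal t v))) 0) ->
  (forall q : quat, ex_derive (fun t : R => g (plus q (scal t v))) 0) -> forall q,
  qderive (fun t => plus (f (plus q (scal t v))) (g (plus q (scal t v)))) 0
    (plus (dir_derive f v q) (dir_derive g v q)).
Proof. intros Hf Hg q. apply qderive_plus; now apply ex_derive_qderive. Qed.

Lemma dir_derive_mult (f g : quat -> quat) (v : quat) :
  (forall q : quat, ex_derive (fun t : R => f (plus q (scal t v))) 0) ->
  (forall q : quat, ex_derive (fun t : R => g (plus q (scal t v))) 0) -> forall q,
  qderive (fun t => mult (f (plus q (scal t v))) (g (plus q (scal t v)))) 0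
    (plus (mult (dir_derive f v q) (g q)) (mult (f q) (dir_derive g v q))).
Proof.
intros Hf Hg q.
assert (H := qderive_mult _ _ _ _ _ (ex_derive_qderive _ _ (Hf q)) (ex_derive_qderive _ _ (Hg q))).
cbv beta in H. rewrite line_0 in H. exact H.
Qed.

Lemma majorized_plus k : forall f g m m', majorized k f m -> majorized k g m' ->
  majorized k (fun q => plus (f q) (g q)) (fun r => m r + m' r).
Proof.
induction k as [|k IH]; intros f g m m' (H1 & H2 & H3) (K1 & K2 & K3);
  (split; [intros; now apply continuous_qplus|split]).
1,3: intros q r Hr; eapply Rle_trans; [apply qnorm_plus|]; apply Rplus_le_compat; auto.
- exact I.
- intros v. destruct (H3 v) as [A B], (K3 v) as [A' B'].
  assert (D := dir_derive_plus f g v A A').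
  split; [intros q; eapply qderive_ex, D|].
  replace (dir_derive (fun q => plus (f q) (g q)) v) with (fun q => plus (dir_derive f v q) (dir_derive g v q)).
  2:{ apply functional_extensionality; intros q; symmetry; apply dir_derive_eq, D. }
  eapply majorized_le; [|apply (IH _ _ _ _ B B')]. intros r Hr. simpl. lra.
Qed.

Lemma ex_derive_const_line (a v : quat) (q : quat) :
  ex_derive (fun t : R => (fun _ : quat => a) (plus q (scal t v))) 0.
Proof. exact (qderive_ex _ _ _ (qderive_const a 0)). Qed.

Lemma ex_derive_id_line (v : quat) (q : quat) :
  ex_derive (fun t : R => (fun p : quat => p) (plus q (scal t v))) 0.
Proof. exact (qderive_ex _ _ _ (qderive_line q v 0)). Qed.

Lemma dir_derive_const a v q : dir_derive (fun _ => a) v q = zero.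
Proof. apply dir_derive_eq, qderive_const. Qed.

Lemma dir_derive_id v q : dir_derive (fun p => p) v q = v.
Proof. apply dir_derive_eq, qderive_line. Qed.

Lemma majorized_scal_l k a : forall h m, majorized k h m ->
  majorized k (fun q => mult a (h q)) (fun r => qnorm a * m r).
Proof.
induction k as [|k IH]; intros h m (H1 & H2 & H3);
  (split; [intros; apply continuous_qmult; [apply continuous_const|apply H1]|split]).
1,3: intros q r Hr; eapply Rle_trans; [apply qnorm_mult|]; apply Rmult_le_compat_l; [apply qnorm_ge0|auto].
- exact I.
- intros v. destruct (H3 v) as [A B].
  assert (D := dir_derive_mult (fun _ => a) h v (ex_derive_const_line a v) A).
  split; [intros q; eapply qderive_ex, D|].
  replace (dir_derive (fun q => mult a (h q)) v) with (fun q => mult a (dir_derive h v q)).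
  2:{ apply functional_extensionality; intros q; symmetry.
      rewrite (dir_derive_eq _ _ _ _ (D q)), dir_derive_const.
      etransitivity; [apply (f_equal (fun z => plus z _)); exact (mult_zero_l (K := quat_Ring) (h q))|].
      apply plus_zero_l. }
  eapply majorized_le; [|apply (IH _ _ B)]. intros r Hr. simpl. apply Req_le; ring.
Qed.

Definition nonneg_mono (m : R -> R) : Prop := forall r s, 0 <= r -> r <= s -> 0 <= m r <= m s.

(** The product rule gives the bound |v| (m r + r m (r + 1)), which for m nonnegative and
    nondecreasing is at most |v| (r + 1) m (r + 1): the shift by 1 absorbs the extra term. *)
Lemma majorized_id_mult k : forall h m, nonneg_mono m -> majorized k h m ->
  majorized k (fun q => mult q (h q)) (fun r => r * m r).
Proof.
induction k as [|k IH]; intros h m Hm HH; assert (HH' := HH); destruct HH' as (H1 & H2 & H3);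
  (split; [intros; apply continuous_qmult; [apply continuous_id|apply H1]|split]).
1,3: intros q r Hr; eapply Rle_trans; [apply qnorm_mult|];
  apply Rmult_le_compat; try apply qnorm_ge0; auto.
- exact I.
- intros v. destruct (H3 v) as [A B].
  assert (D := dir_derive_mult (fun p => p) h v (ex_derive_id_line v) A).
  split; [intros q; eapply qderive_ex, D|].
  replace (dir_derive (fun q => mult q (h q)) v) with (fun q => plus (mult v (h q)) (mult q (dir_derive h v q))).
  2:{ apply functional_extensionality; intros q; symmetry.
      now rewrite (dir_derive_eq _ _ _ _ (D q)), dir_derive_id. }
  assert (Pv := qnorm_ge0 v).
  eapply majorized_le; [|apply majorized_plus; [apply majorized_scal_l, majorized_pred, HH|apply IH, B]].
  + intros r Hr. cbv beta. destruct (Hm r (r + 1)) as [M1 M2]; [lra|lra|].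
    assert (X := Rmult_le_compat_l _ _ _ Pv M2). lra.
  + intros r s Hr Hs. destruct (Hm (r + 1) (s + 1)) as [M1 M2]; [lra|lra|].
    split; [now apply Rmult_le_pos|now apply Rmult_le_compat_l].
Qed.

(** * Entire quaternionic power series *)

Definition monomial (a : quat) (n : nat) (q : quat) : quat := mult (pow_n q n) a.

Lemma majorized_monomial k a n : majorized k (monomial a n) (fun r => r ^ n * qnorm a).
Proof.
induction n as [|n IH].
- replace (monomial a 0) with (fun _ : quat => a).
  2:{ apply functional_extensionality; intros q; symmetry; apply mult_one_l. }
  eapply majorized_le; [|apply majorized_const]. intros; simpl; apply Req_le; ring.
- replace (monomial a (S n)) with (fun q => mult q (monomial a n q)).
  2:{ apply functional_extensionality; intros q; apply mult_assoc. }
  eapply majorized_le; [|apply majorized_id_mult, IH].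
  + intros; simpl; apply Req_le; ring.
  + intros r s Hr Hs. assert (P := qnorm_ge0 a). split.
    * apply Rmult_le_pos; auto. now apply pow_le.
    * apply Rmult_le_compat_r; auto. now apply pow_incr.
Qed.

Definition entire (a : nat -> quat) : Prop :=
  forall r, 0 <= r -> ex_series (fun n => r ^ n * qnorm (a n)).

Definition power_series (a : nat -> quat) : quat -> quat := quat_series (fun n => monomial (a n) n).

Definition smooth (f : quat -> quat) : Prop := forall k, class_C k f.

Lemma power_series_smooth a : entire a -> smooth (power_series a).
Proof.
intros Ha k. apply quat_series_class_C with (fun n r => r ^ n * qnorm (a n)).
- intros n. apply majorized_monomial.
- exact Ha.
Qed.

Lemma class_C_plus k : forall f g, class_C k f -> class_C k g -> class_C k (fun q => plus (f q) (g q)).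
Proof.
induction k as [|k IH]; intros f g Hf Hg.
- intros q. now apply continuous_qplus.
- intros v. destruct (Hf v) as [A B], (Hg v) as [A' B'].
  assert (D := dir_derive_plus f g v A A').
  split; [intros q; eapply qderive_ex, D|].
  replace (dir_derive (fun q => plus (f q) (g q)) v) with (fun q => plus (dir_derive f v q) (dir_derive g v q)).
  2:{ apply functional_extensionality; intros q; symmetry; apply dir_derive_eq, D. }
  now apply IH.
Qed.

(** [class_C (S k)] speaks only of directional derivatives and does not contain [class_C k] by
    definition, yet the product rule keeps an underived factor. Quantifying over all orders supplies
    its regularity. *)
Lemma smooth_mult f g : smooth f -> smooth g -> smooth (fun q => mult (f q) (g q)).
Proof.
intros Hf Hg k; revert f g Hf Hg; induction k as [|k IH]; intros f g Hf Hg.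
- intros q. apply continuous_qmult; [apply (Hf 0%nat)|apply (Hg 0%nat)].
- intros v.
  assert (A := proj1 (Hf 1%nat v)). assert (A' := proj1 (Hg 1%nat v)).
  assert (D := dir_derive_mult f g v A A').
  split; [intros q; eapply qderive_ex, D|].
  replace (dir_derive (fun q => mult (f q) (g q)) v) with
    (fun q => plus (mult (dir_derive f v q) (g q)) (mult (f q) (dir_derive g v q))).
  2:{ apply functional_extensionality; intros q; symmetry; apply dir_derive_eq, D. }
  apply class_C_plus; apply IH; auto; intros j; apply (Hf (S j)) || apply (Hg (S j)).
Qed.

(** * Coordinates and convergence of quaternionic series *)

(** Indices above 3 repeat the last coordinate, so that statements can range over all natural
    numbers. *)
Definition coord (i : nat) (q : quat) : R :=
  match i with O => q0 q | 1%nat => q1 q | 2%nat => q2 q | _ => q3 q end.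

Lemma coord_eq p q : (forall i, coord i p = coord i q) -> p = q.
Proof. intros H; apply quat_eq; [apply (H 0%nat)|apply (H 1%nat)|apply (H 2%nat)|apply (H 3%nat)]. Qed.

Lemma coord_plus i p q : coord i (plus p q) = coord i p + coord i q.
Proof. destruct i as [|[|[|i]]]; reflexivity. Qed.

Lemma coord_opp i p : coord i (opp p) = - coord i p.
Proof. destruct i as [|[|[|i]]]; reflexivity. Qed.

Lemma coord_scal i (t : R) (p : quat) : coord i (scal t p) = t * coord i p.
Proof. destruct i as [|[|[|i]]]; reflexivity. Qed.

Lemma coord_zero i : coord i zero = 0.
Proof. destruct i as [|[|[|i]]]; reflexivity. Qed.

Lemma coord_qderive i phi t l : qderive phi t l -> is_derive (fun s => coord i (phi s)) t (coord i l).
Proof. intros (H0 & H1 & H2 & H3). destruct i as [|[|[|i]]]; assumption. Qed.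

Lemma coord_continuous {T : UniformSpace} i (f : T -> quat) x :
  continuous f x -> continuous (fun t => coord i (f t)) x.
Proof. intros H; apply continuous_quat in H. destruct i as [|[|[|i]]]; apply H. Qed.

Lemma coord_quat_series i T q : coord i (quat_series T q) = Series (fun n => coord i (T n q)).
Proof. destruct i as [|[|[|i]]]; reflexivity. Qed.

Ltac quat_ring :=
  apply quat_eq;
  unfold plus, opp, scal, mult, zero, one, minus; simpl;
  unfold qmult, qone, mkquat, q0, q1, q2, q3; simpl;
  unfold plus, opp, scal, mult, zero, one, minus; simpl;
  unfold mult; simpl; first [ring | field].

Definition qis_series (T : nat -> quat) (l : quat) : Prop :=
  forall i, is_series (fun n => coord i (T n)) (coord i l).

Lemma is_series_Rplus (a b : nat -> R) l m : is_series a l -> is_series b m ->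
  is_series (fun n => a n + b n) (l + m).
Proof. apply (is_series_plus (V := R_NormedModule)). Qed.

Lemma is_series_Rscal (c : R) (a : nat -> R) l : is_series a l -> is_series (fun n => c * a n) (c * l).
Proof. intros H; exact (is_series_scal_l c a l H). Qed.

Lemma qis_series_plus T U l m : qis_series T l -> qis_series U m ->
  qis_series (fun n => plus (T n) (U n)) (plus l m).
Proof.
intros H K i. rewrite coord_plus.
eapply is_series_ext; [|apply is_series_Rplus; [apply (H i)|apply (K i)]].
intros; symmetry; apply coord_plus.
Qed.

Lemma qis_series_scal (c : R) T l : qis_series T l -> qis_series (fun n => scal c (T n)) (scal c l).
Proof.
intros H i. rewrite coord_scal.
eapply is_series_ext; [|apply is_series_Rscal, (H i)].
intros; symmetry; apply coord_scal.
Qed.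

Lemma qis_series_ext T U l : (forall n, T n = U n) -> qis_series T l -> qis_series U l.
Proof. intros E H i. eapply is_series_ext; [|apply H]. intros n; exact (f_equal (coord i) (E n)). Qed.

Lemma qis_series_unique T q l : qis_series (fun n => T n q) l -> quat_series T q = l.
Proof. intros H; apply coord_eq; intros i. rewrite coord_quat_series. apply is_series_unique, H. Qed.

Lemma qis_series_linear (L : quat -> quat) T l :
  (forall i, exists b0 b1 b2 b3 : R, forall q,
     coord i (L q) = b0 * q0 q + b1 * q1 q + b2 * q2 q + b3 * q3 q) ->
  qis_series T l -> qis_series (fun n => L (T n)) (L l).
Proof.
intros HL H i. destruct (HL i) as (b0 & b1 & b2 & b3 & F).
rewrite F. eapply is_series_ext; [intros n; symmetry; apply F|].
repeat apply is_series_Rplus; apply is_series_Rscal; [apply (H 0%nat)|apply (H 1%nat)|apply (H 2%nat)|apply (H 3%nat)].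
Qed.

Lemma qis_series_mult_l a T l : qis_series T l -> qis_series (fun n => mult a (T n)) (mult a l).
Proof.
apply qis_series_linear. destruct i as [|[|[|i]]].
- exists (q0 a), (- q1 a), (- q2 a), (- q3 a). intros; unfold mult; simpl. unfold qmult, mkquat, q0, q1, q2, q3; simpl; ring.
- exists (q1 a), (q0 a), (- q3 a), (q2 a). intros; unfold mult; simpl. unfold qmult, mkquat, q0, q1, q2, q3; simpl; ring.
- exists (q2 a), (q3 a), (q0 a), (- q1 a). intros; unfold mult; simpl. unfold qmult, mkquat, q0, q1, q2, q3; simpl; ring.
- exists (q3 a), (- q2 a), (q1 a), (q0 a). intros; unfold mult; simpl. unfold qmult, mkquat, q0, q1, q2, q3; simpl; ring.
Qed.

Lemma qis_series_mult_r a T l : qis_series T l -> qis_series (fun n => mult (T n) a) (mult l a).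
Proof.
apply (qis_series_linear (fun q => mult q a)). destruct i as [|[|[|i]]].
- exists (q0 a), (- q1 a), (- q2 a), (- q3 a). intros; unfold mult; simpl. unfold qmult, mkquat, q0, q1, q2, q3; simpl; ring.
- exists (q1 a), (q0 a), (q3 a), (- q2 a). intros; unfold mult; simpl. unfold qmult, mkquat, q0, q1, q2, q3; simpl; ring.
- exists (q2 a), (- q3 a), (q0 a), (q1 a). intros; unfold mult; simpl. unfold qmult, mkquat, q0, q1, q2, q3; simpl; ring.
- exists (q3 a), (q2 a), (- q1 a), (q0 a). intros; unfold mult; simpl. unfold qmult, mkquat, q0, q1, q2, q3; simpl; ring.
Qed.

Lemma qis_series_power_series a q : entire a ->
  qis_series (fun n => monomial (a n) n q) (power_series a q).
Proof.
intros Ha i. unfold power_series; rewrite coord_quat_series. apply Series_correct.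
apply ex_series_Rle with (fun n => qnorm q ^ n * qnorm (a n)); [|apply Ha, qnorm_ge0].
intros n. eapply Rle_trans; [|apply (majorized_bound 0 _ _ (majorized_monomial 0 (a n) n)), Rle_refl].
destruct i as [|[|[|i]]]; apply qnorm_comp.
Qed.

(** * Slices *)

Lemma slice_mult K z w : sphere K -> slice K (z * w)%C = mult (slice K z) (slice K w).
Proof.
intros HK. unfold sphere in HK.
assert (E : mult (slice K z) (slice K w) =
  plus (plus (scal (Re z * Re w) (one : quat)) (scal (Im z * Im w) (mult K K)))
       (scal (Re z * Im w + Im z * Re w) K)).
{ unfold slice. generalize (Re z) (Re w) (Im z) (Im w); intros. quat_ring. }
rewrite E, HK. unfold slice. rewrite Re_mult, Im_mult.
generalize (Re z) (Re w) (Im z) (Im w); intros. quat_ring.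
Qed.

Lemma slice_one K : slice K (RtoC 1) = one.
Proof. unfold slice, RtoC, Re, Im; simpl. quat_ring. Qed.

Lemma slice_pow K z n : sphere K -> slice K (z ^ n)%C = pow_n (slice K z) n.
Proof.
intros HK; induction n as [|n IH]; [apply slice_one|].
simpl. now rewrite slice_mult, IH.
Qed.

Lemma slice_real K x : slice K (RtoC x) = scal x (one : quat).
Proof. unfold slice, RtoC, Re, Im; simpl. quat_ring. Qed.

Lemma slice_exists q : exists K z, sphere K /\ q = slice K z.
Proof.
set (s := sqrt (q1 q * q1 q + q2 q * q2 q + q3 q * q3 q)).
assert (P : 0 <= q1 q * q1 q + q2 q * q2 q + q3 q * q3 q) by nra.
assert (S2 := sqrt_sqrt _ P). fold s in S2.
destruct (Req_dec s 0) as [Z|Z].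
- rewrite Z in S2.
  (* A real q lies in every slice; the unit i is an arbitrary choice. *)
  exists (mkquat 0 1 0 0), (RtoC (q0 q)); split.
  + unfold sphere. quat_ring.
  + rewrite slice_real.
    assert (q1 q = 0) by nra. assert (q2 q = 0) by nra. assert (q3 q = 0) by nra.
    apply quat_eq; unfold scal, one; simpl; unfold qone, mkquat in *; unfold q0, q1, q2, q3 in *; simpl in *;
    unfold scal; simpl; unfold mult; simpl; lra.
- exists (mkquat 0 (q1 q / s) (q2 q / s) (q3 q / s)), (q0 q, s); split.
  + unfold sphere.
    assert (N : q1 q / s * (q1 q / s) + q2 q / s * (q2 q / s) + q3 q / s * (q3 q / s) = 1).
    { replace 1 with ((s * s) / (s * s)) by (field; auto). rewrite S2 at 1. field; auto. }
    revert N; generalize (q1 q / s) (q2 q / s) (q3 q / s); intros a b c N.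
    apply quat_eq; unfold mult, opp, one; simpl; unfold qmult, qone, mkquat, q0, q1, q2, q3; simpl; unfold opp; simpl; lra.
  + unfold slice, Re, Im; simpl.
    apply quat_eq; unfold plus, scal, one; simpl; unfold qone, mkquat, q0, q1, q2, q3; simpl;
    unfold plus, scal; simpl; unfold mult; simpl; field; auto.
Qed.

Lemma scal_eq_zero (c : R) (p : quat) : c <> 0 -> scal c p = zero -> p = zero.
Proof.
intros Hc H. apply coord_eq; intros i.
apply (f_equal (coord i)) in H. rewrite coord_scal in H. rewrite coord_zero in *.
destruct (Rmult_integral _ _ H); tauto.
Qed.

Lemma qderive_restr_x f K x y : class_C 1 f ->
  qderive (fun s => restr f K s y) x (dir_derive f one (slice K (x, y))).
Proof.
intros Hf.
assert (E : forall s, plus (scal y K) (scal s (one : quat)) = slice K (s, y)).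
{ intros s. unfold slice, Re, Im; simpl. apply plus_comm. }
rewrite <- E. eapply qderive_ext; [|apply dir_derive_qderive, (proj1 (Hf one))].
intros s. unfold restr. now rewrite <- E.
Qed.

Lemma qderive_restr_y f K x y : class_C 1 f ->
  qderive (fun s => restr f K x s) y (dir_derive f K (slice K (x, y))).
Proof.
intros Hf.
exact (dir_derive_qderive f K (scal x (one : quat)) y (proj1 (Hf K))).
Qed.

Lemma qmult_assoc (p q r : quat) : mult p (mult q r) = mult (mult p q) r.
Proof. apply (mult_assoc (K := quat_Ring)). Qed.

Lemma sphere_mult_mult K q : sphere K -> mult K (mult K q) = opp q.
Proof. intros HK. rewrite qmult_assoc. unfold sphere in HK. rewrite HK. quat_ring. Qed.

Lemma slice_regular_CR f K q : slice_regular f -> sphere K ->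
  (exists x y, q = slice K (x, y)) -> dir_derive f K q = mult K (dir_derive f one q).
Proof.
intros [Hc Hd] HK (x & y & ->).
assert (H := Hd K HK x y). simpl in H. unfold dbar in H.
apply scal_eq_zero in H; [|lra].
rewrite (qderive_unique _ _ _ (qderive_restr_x f K x y Hc)) in H.
rewrite (qderive_unique _ _ _ (qderive_restr_y f K x y Hc)) in H.
apply (f_equal (mult K)) in H.
set (fx := dir_derive f one _) in *. set (fy := dir_derive f K _) in *.
assert (E : mult K (plus fx (mult K fy)) = plus (mult K fx) (mult K (mult K fy))) by
  apply (mult_distr_l (K := quat_Ring)).
rewrite E, sphere_mult_mult in H by exact HK.
apply coord_eq; intros i. apply (f_equal (coord i)) in H.
rewrite coord_plus, coord_opp in H.
assert (H' := eq_trans H (eq_trans (f_equal (coord i) (mult_zero_r (K := quat_Ring) K)) (coord_zero i))). lra.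
Qed.

Lemma continuity_2d_slice (h : quat -> quat) K i x y : (forall q, continuous h q) ->
  continuity_2d_pt (fun x y => coord i (h (slice K (x, y)))) x y.
Proof.
intros Hh. apply continuity_2d_pt_filterlim.
change (continuous (fun z : R * R => coord i (h (slice K (fst z, snd z)))) (x, y)).
apply coord_continuous.
apply (continuous_comp (fun z : R * R => slice K (fst z, snd z)) h); [|apply Hh].
unfold slice, Re, Im; simpl.
apply continuous_qplus.
- apply (continuous_scal_l (K := R_AbsRing) (V := quat_NormedModule) (fun z : R * R => fst z)). apply continuous_fst.
- apply (continuous_scal_l (K := R_AbsRing) (V := quat_NormedModule) (fun z : R * R => snd z)). apply continuous_snd.
Qed.

(** Since f_y = K f_x on C_K, coordinate i of f and coordinate i of -K f satisfy the Cauchy-Riemann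
    equations. Complex analysis thus applies to f coordinate by coordinate, without choosing a unit
    orthogonal to K. *)
Lemma slice_regular_conjugate_pair f K i : slice_regular f -> sphere K ->
  conjugate_pair (fun x y => coord i (f (slice K (x, y))))
    (fun x y => coord i (opp (mult K (f (slice K (x, y))))))
    (fun x y => coord i (dir_derive f one (slice K (x, y))))
    (fun x y => coord i (dir_derive f K (slice K (x, y)))).
Proof.
intros Hf HK x y. assert (Hc := proj1 Hf).
assert (CR : dir_derive f K (slice K (x, y)) = mult K (dir_derive f one (slice K (x, y)))).
{ apply slice_regular_CR; auto. now exists x, y. }
assert (X := qderive_restr_x f K x y Hc). assert (Y := qderive_restr_y f K x y Hc).
assert (M : forall phi t l, qderive phi t l -> is_derive (fun s => coord i (opp (mult K (phi s)))) t (- coord i (mult K l))).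
{ intros phi t l H.
  apply is_derive_ext with (fun s => - coord i (mult K (phi s))); [intros; symmetry; apply coord_opp|].
  apply (is_derive_opp (V := R_NormedModule)). apply coord_qderive.
  assert (H' := qderive_mult _ _ _ _ _ (qderive_const K t) H).
  replace (mult K l) with (plus (mult (zero : quat) (phi t)) (mult K l)); [exact H'|].
  quat_ring. }
refine (conj _ (conj _ (conj _ (conj _ (conj _ _))))).
- exact (coord_qderive i _ _ _ X).
- exact (coord_qderive i _ _ _ Y).
- rewrite CR. exact (M _ _ _ X).
- replace (coord i (dir_derive f one (slice K (x, y)))) with (- coord i (mult K (dir_derive f K (slice K (x, y))))).
  + exact (M _ _ _ Y).
  + rewrite CR, sphere_mult_mult, coord_opp by exact HK. ring.
- apply continuity_2d_slice, (proj2 (Hc one)).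
- apply continuity_2d_slice, (proj2 (Hc K)).
Qed.

(** * The Taylor series of a slice regular function *)

(** [slice zero (x, 0)] is the real number x; this keeps any imaginary unit out of the
    definition. *)
Definition taylor_coef (f : quat -> quat) (n : nat) : quat :=
  let c i := Derive_n (fun x => coord i (f (slice zero (x, 0)))) n 0 / INR (Factorial.fact n) in
  mkquat (c 0%nat) (c 1%nat) (c 2%nat) (c 3%nat).

Lemma coord_taylor_coef f n i : coord i (taylor_coef f n) =
  Derive_n (fun x => coord i (f (slice zero (x, 0)))) n 0 / INR (Factorial.fact n).
Proof. destruct i as [|[|[|i]]]; reflexivity. Qed.

Lemma slice_real_indep K L x : slice K (x, 0) = slice L (x, 0).
Proof. change (slice K (RtoC x) = slice L (RtoC x)). now rewrite 2!slice_real. Qed.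

(* Along each slice the coefficients are read off the real axis, hence do not depend on the slice. *)
Lemma slice_regular_series f K z : slice_regular f -> sphere K ->
  qis_series (fun n => monomial (taylor_coef f n) n (slice K z)) (f (slice K z)).
Proof.
intros Hf HK.
assert (A : forall i, exists c : nat -> C, forall w : C,
    is_series (fun n => Re (w ^ n * c n)%C) (coord i (f (slice K w))) /\
    is_series (fun n => Im (w ^ n * c n)%C) (coord i (opp (mult K (f (slice K w)))))).
{ intros i. destruct (entire_expansion _ _ _ _ (slice_regular_conjugate_pair f K i Hf HK)) as [c Hc].
  exists c. intros [x y]. apply (Hc (x, y)). }
assert (B : forall i c, (forall w : C,
    is_series (fun n => Re (w ^ n * c n)%C) (coord i (f (slice K w))) /\
    is_series (fun n => Im (w ^ n * c n)%C) (coord i (opp (mult K (f (slice K w)))))) ->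
    forall n, Re (c n) = coord i (taylor_coef f n)).
{ intros i c Hc n. rewrite coord_taylor_coef.
  apply (is_pseries_coef (fun n => Re (c n)) _ 1 Rlt_0_1). intros x _.
  rewrite (slice_real_indep zero K).
  eapply is_series_ext; [|apply (proj1 (Hc (RtoC x)))]. intros; apply RtoC_Re_mult. }
assert (S : forall x, qis_series (fun n => scal (x ^ n) (taylor_coef f n)) (f (slice K (RtoC x)))).
{ intros x i. destruct (A i) as [c Hc].
  eapply is_series_ext; [|apply (proj1 (Hc (RtoC x)))].
  intros n. cbv beta. now rewrite RtoC_Re_mult, (B i c Hc), coord_scal. }
intros i. destruct (A i) as [c Hc].
(* On the real axis the conjugate function -K f has the series of f multiplied by -K; uniqueness
   then gives the imaginary parts of [c]. *)
assert (Im_c : forall n, Im (c n) = - coord i (mult K (taylor_coef f n))).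
{ intros n.
  rewrite (is_pseries_coef (fun n => Im (c n)) (fun x => coord i (opp (mult K (f (slice K (RtoC x)))))) 1 Rlt_0_1).
  - symmetry.
    apply (is_pseries_coef (fun n => - coord i (mult K (taylor_coef f n))) (fun x => coord i (opp (mult K (f (slice K (RtoC x)))))) 1 Rlt_0_1).
    intros x _. assert (Q := is_series_Rscal (-1) _ _ (qis_series_mult_l K _ _ (S x) i)).
    rewrite coord_opp. replace (- coord i (mult K (f (slice K (RtoC x))))) with (-1 * coord i (mult K (f (slice K (RtoC x))))) by ring.
    eapply is_series_ext; [|exact Q]. intros k. cbv beta.
    replace (mult K (scal (x ^ k) (taylor_coef f k))) with (scal (x ^ k) (mult K (taylor_coef f k))).
    + rewrite coord_scal. simpl; ring.
    + generalize (x ^ k) (taylor_coef f k); intros. quat_ring.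
  - intros x _. eapply is_series_ext; [|apply (proj2 (Hc (RtoC x)))]. intros; apply RtoC_Im_mult. }
(* Writing a_n for [taylor_coef f n], [c n] has real part (a_n)_i and imaginary part -(K a_n)_i, so
   the real part of z^n c_n is coordinate i of (Re z^n + Im z^n K) a_n. *)
eapply is_series_ext; [|apply (proj1 (Hc z))].
intros n. unfold monomial. rewrite <- slice_pow by exact HK.
rewrite Re_mult, (B i c Hc), Im_c.
unfold slice.
replace (mult (plus (scal (Re (z ^ n)%C) (one : quat)) (scal (Im (z ^ n)%C) K)) (taylor_coef f n)) with
  (plus (scal (Re (z ^ n)%C) (taylor_coef f n)) (scal (Im (z ^ n)%C) (mult K (taylor_coef f n)))).
- rewrite coord_plus, 2!coord_scal. match goal with |- @eq _ ?a ?b => change (@eq R a b) end. ring.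
- generalize (Re (z ^ n)%C) (Im (z ^ n)%C) (taylor_coef f n); intros. quat_ring.
Qed.

Lemma CV_radius_infinite (a : nat -> R) : (forall x, 0 <= x -> ex_series (fun n => x ^ n * a n)) ->
  forall x : R, Rbar_lt (Rabs x) (CV_radius a).
Proof.
intros H x. apply Rbar_lt_le_trans with (Finite (Rabs (Rabs x + 1))).
- simpl. assert (P := Rabs_pos x). rewrite (Rabs_pos_eq (Rabs x + 1)); lra.
- apply Rbar_not_lt_le; intros L. apply (CV_disk_outside _ _ L). apply ex_series_lim_0.
  eapply ex_series_ext; [|apply (H (Rabs x + 1))]; [intros; apply Rmult_comm|].
  assert (P := Rabs_pos x); lra.
Qed.

(** Convergence on the real axis suffices: there each coordinate is a real power series, and one
    that converges at every real point converges absolutely at each of them. *)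
Lemma slice_regular_entire f : slice_regular f -> entire (taylor_coef f).
Proof.
intros Hf r Hr.
set (K := mkquat 0 1 0 0). assert (HK : sphere K) by (unfold sphere, K; quat_ring).
assert (S : forall i, ex_series (fun n => r ^ n * Rabs (coord i (taylor_coef f n)))).
{ intros i.
  assert (Q : forall x, ex_series (fun n => x ^ n * coord i (taylor_coef f n))).
  { intros x. exists (coord i (f (slice K (RtoC x)))).
    eapply is_series_ext; [|apply (slice_regular_series f K (RtoC x) Hf HK i)].
    intros n. unfold monomial. rewrite <- slice_pow, <- RtoC_pow, slice_real by exact HK.
    replace (mult (scal (x ^ n) (one : quat)) (taylor_coef f n)) with (scal (x ^ n) (taylor_coef f n)).
    - apply coord_scal.
    - generalize (x ^ n) (taylor_coef f n); intros. quat_ring. }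
  eapply ex_series_ext; [|apply (CV_disk_inside (fun n => coord i (taylor_coef f n)) r)].
  - intros n. cbv beta. rewrite Rabs_mult, (Rabs_pos_eq (r ^ n)); [apply Rmult_comm|now apply pow_le].
  - apply CV_radius_infinite. intros; apply Q. }
assert (P := fun a b => ex_series_plus (V := R_NormedModule) (K := R_AbsRing) a b).
apply (ex_series_ext (fun n => r ^ n * Rabs (coord 0 (taylor_coef f n)) + r ^ n * Rabs (coord 1 (taylor_coef f n))
   + r ^ n * Rabs (coord 2 (taylor_coef f n)) + r ^ n * Rabs (coord 3 (taylor_coef f n)))).
- intros n. unfold qnorm; simpl. match goal with |- @eq _ ?a ?b => change (@eq R a b) end. ring.
- exact (P _ _ (P _ _ (P _ _ (S 0%nat) (S 1%nat)) (S 2%nat)) (S 3%nat)).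
Qed.

Lemma slice_regular_power_series f : slice_regular f -> f = power_series (taylor_coef f).
Proof.
intros Hf. apply functional_extensionality; intros q.
destruct (slice_exists q) as (K & z & HK & ->).
symmetry. apply (qis_series_unique (fun n => monomial (taylor_coef f n) n)).
now apply slice_regular_series.
Qed.

Lemma qmult_0_l (q : quat) : mult (zero : quat) q = zero.
Proof. quat_ring. Qed.

Lemma qmult_0_r (q : quat) : mult q (zero : quat) = zero.
Proof. quat_ring. Qed.

Lemma qscal_0_l (q : quat) : scal 0 q = zero.
Proof. quat_ring. Qed.

Lemma qscal_0_r (c : R) : scal c (zero : quat) = zero.
Proof. quat_ring. Qed.

Lemma qmult_plus_r (p q r : quat) : mult p (plus q r) = plus (mult p q) (mult p r).
Proof. quat_ring. Qed.

Lemma qmult_plus_l (p q r : quat) : mult (plus p q) r = plus (mult p r) (mult q r).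
Proof. quat_ring. Qed.

Lemma qmult_scal_r (c : R) (p q : quat) : mult p (scal c q) = scal c (mult p q).
Proof. quat_ring. Qed.

Lemma qmult_scal_l (c : R) (p q : quat) : mult (scal c p) q = scal c (mult p q).
Proof. quat_ring. Qed.

Lemma qmult_opp_r (p q : quat) : mult p (opp q) = opp (mult p q).
Proof. quat_ring. Qed.

Lemma qmult_opp_l (p q : quat) : mult (opp p) q = opp (mult p q).
Proof. quat_ring. Qed.

Lemma qmult_one_r (q : quat) : mult q (one : quat) = q.
Proof. quat_ring. Qed.

Lemma qmult_one_l (q : quat) : mult (one : quat) q = q.
Proof. quat_ring. Qed.

(** * Derivatives of power series along a slice *)

Definition dcoef (b : nat -> quat) (n : nat) : quat := scal (INR (S n)) (b (S n)).

Lemma entire_dcoef b : entire b -> entire (dcoef b).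
Proof.
intros Hb r Hr.
assert (L : Rbar_lt (Rabs r) (CV_radius (PS_derive (fun n => qnorm (b n))))).
{ rewrite CV_radius_derive. now apply CV_radius_infinite. }
apply CV_disk_inside in L.
revert L; apply ex_series_ext; intros n. cbv beta.
unfold dcoef, PS_derive. rewrite qnorm_scal.
assert (P1 := pos_INR (S n)). assert (P2 := qnorm_ge0 (b (S n))). assert (P3 := pow_le r n Hr).
rewrite Rabs_pos_eq.
- rewrite (Rabs_pos_eq (INR (S n))) by auto. apply Rmult_comm.
- apply Rmult_le_pos; auto. now apply Rmult_le_pos.
Qed.

(** In general the derivative of q^n along v is the sum of the q^i v q^j with i + j = n - 1; when v
    commutes with q these terms coincide. For n = 0 the value [pred 0 = 0] is harmless, the factor
    [INR 0] being zero. *)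
Lemma qderive_pow (q v : quat) n : mult q v = mult v q ->
  qderive (fun t => pow_n (plus q (scal t v) : quat) n) 0 (scal (INR n) (mult v (pow_n q (pred n)))).
Proof.
intros C; induction n as [|n IH].
- change (scal (INR 0) (mult v (pow_n q (pred 0)))) with (scal 0 (mult v (one : quat))).
  rewrite qscal_0_l. exact (qderive_const one 0).
- assert (H := qderive_mult _ _ _ _ _ (qderive_line q v 0) IH).
  cbv beta in H. do 2 try rewrite line_0 in H.
  replace (scal (INR (S n)) (mult v (pow_n q (pred (S n))))) with
    (plus (mult v (pow_n q n)) (mult q (scal (INR n) (mult v (pow_n q (pred n)))))); [exact H|].
  assert (E : mult q (scal (INR n) (mult v (pow_n q (pred n)))) = scal (INR n) (mult v (pow_n q n))).
  { destruct n as [|n].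
    - change (INR 0) with 0. rewrite 2!qscal_0_l. apply qmult_0_r.
    - change (pow_n q (S n)) with (mult q (pow_n q n)). simpl pred.
      rewrite (qmult_assoc v q), <- C, <- (qmult_assoc q v).
      generalize (INR (S n)) (mult v (pow_n q n)); intros. quat_ring. }
  rewrite E, S_INR. simpl pred. generalize (INR n) (mult v (pow_n q n)); intros. quat_ring.
Qed.

Lemma dir_derive_monomial (a : quat) n (q v : quat) : mult q v = mult v q ->
  dir_derive (monomial a n) v q = mult v (monomial (scal (INR n) a) (pred n) q).
Proof.
intros C. apply dir_derive_eq.
assert (H := qderive_mult _ _ _ _ _ (qderive_pow q v n C) (qderive_const a 0)).
cbv beta in H. rewrite line_0, qmult_0_r in H.
replace (mult v (monomial (scal (INR n) a) (pred n) q)) with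
  (plus (mult (scal (INR n) (mult v (pow_n q (pred n)))) a) zero); [exact H|].
unfold monomial. generalize (INR n) (pow_n q (pred n)); intros. quat_ring.
Qed.

Lemma dir_derive_power_series b (q v : quat) : entire b -> mult q v = mult v q ->
  dir_derive (power_series b) v q = mult v (power_series (dcoef b) q).
Proof.
intros Hb C.
assert (D : dir_derive (power_series b) v q = quat_series (fun n => dir_derive (monomial (b n) n) v) q).
{ apply dir_derive_eq. apply (quat_series_qderive 0 _ (fun n r => r ^ n * qnorm (b n))); [|exact Hb].
  intros; apply majorized_monomial. }
rewrite D. apply qis_series_unique.
apply qis_series_ext with (fun n => mult v (monomial (scal (INR n) (b n)) (pred n) q)).
{ intros n; symmetry; now apply dir_derive_monomial. }
apply qis_series_mult_l.
(* The term of index 0 carries the factor [INR 0]; dropping it turns [pred n] into the index of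
   [dcoef]. *)
intros i. apply (is_series_decr_1 (V := R_NormedModule)).
change (INR 0) with 0.
replace (plus _ _) with (coord i (power_series (dcoef b) q)).
- apply (qis_series_power_series (dcoef b) q (entire_dcoef b Hb) i).
- unfold monomial. rewrite qscal_0_l, qmult_0_r, coord_zero.
  change (coord i (power_series (dcoef b) q) = coord i (power_series (dcoef b) q) + - 0). ring.
Qed.

(** * The Cauchy-Riemann operator on products *)

Definition slice_CR (K : quat) (U Ux : R -> R -> quat) : Prop :=
  forall x y, qderive (fun s => U s y) x (Ux x y) /\ qderive (fun s => U x s) y (mult K (Ux x y)).

Lemma power_series_slice_CR K b : sphere K -> entire b ->
  slice_CR K (restr (power_series b) K) (restr (power_series (dcoef b)) K).
Proof.
intros HK Hb x y. assert (Hc := power_series_smooth b Hb 1%nat).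
assert (X := qderive_restr_x _ K x y Hc). assert (Y := qderive_restr_y _ K x y Hc).
rewrite dir_derive_power_series in X, Y; auto.
- rewrite qmult_one_l in X. split; assumption.
- unfold slice, Re, Im; simpl. quat_ring.
- now rewrite qmult_one_l, qmult_one_r.
Qed.

(* Writing [p = u + w J'] with u, w in the slice of K and J' orthogonal to K, this is [w J']. *)
Definition twist (K p : quat) : quat := scal (1 / 2) (plus p (mult (mult K p) K)).

Lemma qderive_mult_l a phi t l : qderive phi t l -> qderive (fun s => mult a (phi s)) t (mult a l).
Proof.
intros H. assert (H' := qderive_mult _ _ _ _ _ (qderive_const a t) H).
eapply eq_rect; [exact H'|]. generalize (phi t); intros. quat_ring.
Qed.

Lemma qderive_mult_r a phi t l : qderive phi t l -> qderive (fun s => mult (phi s) a) t (mult l a).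
Proof.
intros H. assert (H' := qderive_mult _ _ _ _ _ H (qderive_const a t)).
eapply eq_rect; [exact H'|]. generalize (phi t); intros. quat_ring.
Qed.

Lemma qderive_scal (c : R) phi t l : qderive phi t l -> qderive (fun s => scal c (phi s)) t (scal c l).
Proof.
intros (H0 & H1 & H2 & H3).
refine (conj _ (conj _ (conj _ _))); apply is_derive_scal; assumption.
Qed.

Lemma qderive_twist K phi t l : qderive phi t l -> qderive (fun s => twist K (phi s)) t (twist K l).
Proof.
intros H. unfold twist.
apply qderive_scal, qderive_plus; [exact H|].
apply (qderive_mult_r K (fun s => mult K (phi s))), qderive_mult_l, H.
Qed.

Lemma twist_mult (K p : quat) : twist K (mult K p) = mult K (twist K p).
Proof. unfold twist. now rewrite qmult_scal_r, qmult_plus_r, (qmult_assoc K (mult K p) K). Qed.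

(** Sending p to K p K is an involution because K K = -1, so half of its sum with the identity is a
    projection. *)
Lemma twist_idem (K p : quat) : sphere K -> twist K (twist K p) = twist K p.
Proof.
intros HK.
assert (E : mult (mult K (mult (mult K p) K)) K = p).
{ rewrite (qmult_assoc K (mult K p) K), sphere_mult_mult, <- qmult_assoc by exact HK.
  unfold sphere in HK. rewrite HK. quat_ring. }
unfold twist at 1. unfold twist at 2.
rewrite qmult_scal_r, qmult_scal_l, qmult_plus_r, qmult_plus_l, E.
unfold twist. generalize (mult (mult K p) K); intros. quat_ring.
Qed.

(** Left multiplication by K commutes with [twist], so twisting preserves the equation U_y = K U_x
    and [dbar_mult] can be applied again. *)
Lemma slice_CR_twist K U Ux : slice_CR K U Ux ->
  slice_CR K (fun x y => twist K (U x y)) (fun x y => twist K (Ux x y)).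
Proof.
intros H x y; destruct (H x y) as [A B]; split; [now apply qderive_twist|].
rewrite <- twist_mult. now apply qderive_twist.
Qed.

(** In U_x W + U W_x + K (K U_x W + U K W_x) the terms in U_x cancel by K K = -1. If K commuted with
    U the others would cancel too; what remains, (U + K U K) W_x, measures the failure. *)
Lemma dbar_mult K U Ux W Wx x y : sphere K -> slice_CR K U Ux -> slice_CR K W Wx ->
  dbar K (fun x y => mult (U x y) (W x y)) x y = mult (twist K (U x y)) (Wx x y).
Proof.
intros HK HU HW. destruct (HU x y) as [A B]; destruct (HW x y) as [A' B'].
unfold dbar.
rewrite (qderive_unique _ _ _ (qderive_mult _ _ _ _ _ A A')).
rewrite (qderive_unique _ _ _ (qderive_mult _ _ _ _ _ B B')).
cbv beta. generalize (U x y) (Ux x y) (W x y) (Wx x y); intros u ux w wx.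
assert (E : mult K (plus (mult (mult K ux) w) (mult u (mult K wx))) =
  plus (mult (mult K (mult K ux)) w) (mult (mult (mult K u) K) wx))
  by now rewrite qmult_plus_r, !qmult_assoc.
rewrite E, sphere_mult_mult by exact HK. unfold twist.
rewrite qmult_opp_l, qmult_scal_l, qmult_plus_l.
generalize (mult (mult (mult K u) K) wx) (mult ux w) (mult u wx); intros. quat_ring.
Qed.

Lemma iter_dcoef_entire b n : entire b -> entire (Nat.iter n dcoef b).
Proof. intros Hb; induction n as [|n IH]; [exact Hb|]. now apply entire_dcoef. Qed.

(* Since [twist] is idempotent, every further [dbar] only differentiates the second factor. *)
Lemma iter_dbar_mult K a b n : sphere K -> entire a -> entire b ->
  Nat.iter (S n) (dbar K) (fun x y => mult (restr (power_series a) K x y) (restr (power_series b) K x y)) =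
  (fun x y => mult (twist K (restr (power_series a) K x y))
     (restr (power_series (Nat.iter (S n) dcoef b)) K x y)).
Proof.
intros HK Ha Hb. assert (CA := power_series_slice_CR K a HK Ha).
induction n as [|n IH].
- apply functional_extensionality; intros x. apply functional_extensionality; intros y.
  apply (dbar_mult K _ _ _ _ x y HK CA (power_series_slice_CR K b HK Hb)).
- change (Nat.iter (S (S n)) (dbar K)) with (fun u => dbar K (Nat.iter (S n) (dbar K) u)). cbv beta.
  rewrite IH.
  apply functional_extensionality; intros x. apply functional_extensionality; intros y.
  rewrite (dbar_mult K _ _ _ _ x y HK (slice_CR_twist K _ _ CA)
    (power_series_slice_CR K _ HK (iter_dcoef_entire b (S n) Hb))).
  now rewrite twist_idem.
Qed.

(** The constant is (k + m)! / m!; what matters is that it is nonzero. *)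
Lemma iter_dcoef b k : forall m, exists c, c <> 0 /\ Nat.iter k dcoef b m = scal c (b (k + m)%nat).
Proof.
induction k as [|k IH]; intros m.
- exists 1; split; [lra|]. simpl. quat_ring.
- destruct (IH (S m)) as (c & Hc & E). exists (INR (S m) * c); split.
  + apply Rmult_integral_contrapositive_currified; auto. apply not_0_INR; lia.
  + change (Nat.iter (S k) dcoef b m) with (scal (INR (S m)) (Nat.iter k dcoef b (S m))).
    rewrite E. replace (k + S m)%nat with (S k + m)%nat by lia.
    generalize (INR (S m)) (b (S k + m)%nat); intros. quat_ring.
Qed.

(** * Absence of zero divisors, and orthogonal imaginary units *)

Definition qsq (q : quat) : R := dot q q.

(** Euler's four-square identity. *)
Lemma qsq_mult (p q : quat) : qsq (mult p q) = qsq p * qsq q.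
Proof. unfold qsq, dot, mult; simpl; unfold qmult, mkquat, q0, q1, q2, q3; simpl. ring. Qed.

Lemma qsq_eq_0 q : qsq q = 0 -> q = zero.
Proof.
unfold qsq, dot; intros H.
apply quat_eq; [change (q0 q = 0)|change (q1 q = 0)|change (q2 q = 0)|change (q3 q = 0)]; nra.
Qed.

Lemma qsq_zero : qsq (zero : quat) = 0.
Proof. change (0 * 0 + 0 * 0 + 0 * 0 + 0 * 0 = 0). ring. Qed.

Lemma qmult_integral (p q : quat) : mult p q = zero -> p = zero \/ q = zero.
Proof.
intros H. apply (f_equal qsq) in H. rewrite qsq_mult in H.
destruct (Rmult_integral _ _ (eq_trans H qsq_zero)); [left|right]; now apply qsq_eq_0.
Qed.

Lemma sphere_coords K : sphere K -> q0 K = 0 /\ q1 K * q1 K + q2 K * q2 K + q3 K * q3 K = 1.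
Proof.
intros H.
assert (E0 := f_equal q0 H); assert (E1 := f_equal q1 H); assert (E2 := f_equal q2 H); assert (E3 := f_equal q3 H).
destruct K as [[[a b] c] d].
change (a * a - b * b - c * c - d * d = - 1) in E0.
change (a * b + b * a + c * d - d * c = - 0) in E1.
change (a * c - b * d + c * a + d * b = - 0) in E2.
change (a * d + b * c - c * b + d * a = - 0) in E3.
change (a = 0 /\ b * b + c * c + d * d = 1).
assert (A : a = 0).
{ destruct (Req_dec a 0) as [Z|Z]; [exact Z|exfalso].
  assert (b = 0) by (apply Rmult_eq_reg_l with a; lra).
  assert (c = 0) by (apply Rmult_eq_reg_l with a; lra).
  assert (d = 0) by (apply Rmult_eq_reg_l with a; lra). subst. nra. }
subst; split; [reflexivity|lra].
Qed.

Lemma slice_eq_zero K z : sphere K -> slice K z = zero -> z = RtoC 0.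
Proof.
intros HK H. destruct (sphere_coords K HK) as [K0 K1].
assert (E : qsq (slice K z) = Re z * Re z + Im z * Im z).
{ unfold slice, qsq, dot. generalize (Re z) (Im z); intros x y.
  change ((x * 1 + y * q0 K) * (x * 1 + y * q0 K) + (x * 0 + y * q1 K) * (x * 0 + y * q1 K)
     + (x * 0 + y * q2 K) * (x * 0 + y * q2 K) + (x * 0 + y * q3 K) * (x * 0 + y * q3 K) = x * x + y * y).
  rewrite K0. transitivity (x * x + y * y * (q1 K * q1 K + q2 K * q2 K + q3 K * q3 K)); [ring|].
  rewrite K1; ring. }
assert (Z := eq_trans (f_equal qsq H) qsq_zero). rewrite Z in E.
apply injective_projections; [change (Re z = 0)|change (Im z = 0)]; nra.
Qed.

(** Elements of the sphere are purely imaginary, and for such quaternions I J + J I is the real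
    number -2 [dot I J]. *)
Lemma perp_anticommute (I J : quat) : sphere I -> sphere J -> perp I J -> mult J I = opp (mult I J).
Proof.
intros HI HJ HIJ. destruct (sphere_coords I HI) as [I0 _]; destruct (sphere_coords J HJ) as [J0 _].
unfold perp, dot in HIJ.
destruct I as [[[a b] c] d]; destruct J as [[[a' b'] c'] d'].
unfold q0, q1, q2, q3 in *; simpl in *; subst.
apply quat_eq; unfold mult, opp; simpl; unfold qmult, mkquat, q0, q1, q2, q3; simpl; unfold opp; simpl; lra.
Qed.

(** The part w in C_I commutes with I, so I w I = -w and it drops out. As J anticommutes with I, I
    (z J) I = z J and this part is kept. *)
Lemma twist_split (I J : quat) w z : sphere I -> sphere J -> perp I J ->
  twist I (plus (slice I w) (mult (slice I z) J)) = mult (slice I z) J.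
Proof.
intros HI HJ HIJ. assert (A := perp_anticommute I J HI HJ HIJ).
assert (C : forall z, mult I (slice I z) = mult (slice I z) I) by (intros; unfold slice; quat_ring).
assert (R : forall p, mult (mult p I) I = opp p).
{ intros p. rewrite <- qmult_assoc. unfold sphere in HI. rewrite HI. quat_ring. }
assert (E1 : mult (mult I (slice I w)) I = opp (slice I w)) by now rewrite C, R.
assert (E2 : mult (mult I (mult (slice I z) J)) I = mult (slice I z) J).
{ rewrite (qmult_assoc I), C, <- qmult_assoc, A, qmult_opp_r, qmult_assoc, R, qmult_opp_l.
  generalize (mult (slice I z) J); intros. quat_ring. }
unfold twist. rewrite qmult_plus_r, qmult_plus_l, E1, E2.
generalize (slice I w) (mult (slice I z) J); intros. quat_ring.
Qed.

(** * Zero products of real power series *)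

Lemma sum_f_R0_single (f : nat -> R) k n : (k <= n)%nat ->
  (forall j, (j <= n)%nat -> j <> k -> f j = 0) -> sum_f_R0 f n = f k.
Proof.
intros Hk; induction n as [|n IH]; intros H.
- replace k with 0%nat by lia. reflexivity.
- simpl. destruct (Nat.eq_dec k (S n)) as [->|N].
  + rewrite sum_eq_R0; [ring|]. intros j Hj; apply H; lia.
  + rewrite IH, (H (S n)); try lia; [ring|]. intros; apply H; lia.
Qed.

(** Let k be the least index with a_k nonzero. Once b_j = 0 for all j < n, the coefficient of index
    k + n in the product reduces to a_k b_n. *)
Lemma PS_mult_integral (a b : nat -> R) : (forall n, PS_mult a b n = 0) ->
  forall i, a i <> 0 -> forall n, b n = 0.
Proof.
intros H i Hi.
assert (M : exists k, a k <> 0 /\ forall j, (j < k)%nat -> a j = 0).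
{ induction i as [i IHi] using (well_founded_induction Wf_nat.lt_wf).
  destruct (Classical_Prop.classic (exists j, (j < i)%nat /\ a j <> 0)) as [(j & Hj & Hj')|N].
  - now apply (IHi j).
  - exists i; split; auto. intros j Hj. apply Classical_Prop.NNPP; intros Z. apply N; eauto. }
destruct M as (k & Hk & Hmin).
intros n; induction n as [n IHn] using (well_founded_induction Wf_nat.lt_wf).
assert (E := H (k + n)%nat). unfold PS_mult in E.
rewrite (sum_f_R0_single _ k) in E; [| lia |].
- replace (k + n - k)%nat with n in E by lia. destruct (Rmult_integral _ _ E); tauto.
- intros j Hj Hjk. destruct (Nat.lt_ge_cases j k) as [L|L].
  + rewrite Hmin by exact L; ring.
  + rewrite (IHn (k + n - j)%nat) by lia; ring.
Qed.

(** The product function vanishes, so by uniqueness the Cauchy product of the coefficients is zero,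
    and formal power series have no zero divisors. *)
Lemma series_integral (a b : nat -> R) (phi psi : R -> R) :
  (forall x, is_series (fun n => x ^ n * a n) (phi x)) ->
  (forall x, is_series (fun n => x ^ n * b n) (psi x)) ->
  (forall x, phi x * psi x = 0) ->
  forall i, a i <> 0 -> forall n, b n = 0.
Proof.
intros Ha Hb H. apply PS_mult_integral.
assert (Ra : forall x : R, Rbar_lt (Rabs x) (CV_radius a)) by (apply CV_radius_infinite; intros x _; exists (phi x); apply Ha).
assert (Rb : forall x : R, Rbar_lt (Rabs x) (CV_radius b)) by (apply CV_radius_infinite; intros x _; exists (psi x); apply Hb).
intros n.
rewrite (is_pseries_coef (PS_mult a b) (fun _ => 0) 1 Rlt_0_1).
- replace (Derive_n (fun _ => 0) n 0) with 0; [unfold Rdiv; ring|].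
  destruct n; [reflexivity|]. symmetry; apply Derive_n_const.
- intros x _.
  assert (Q : forall c phi, (forall x, is_series (fun n => x ^ n * c n) (phi x)) -> PSeries c x = phi x).
  { intros c p Hc. unfold PSeries. apply is_series_unique. eapply is_series_ext; [|apply Hc]. intros; apply Rmult_comm. }
  assert (PM := is_pseries_mult a b x _ _ (PSeries_correct _ _ (CV_radius_inside _ _ (Ra x)))
     (PSeries_correct _ _ (CV_radius_inside _ _ (Rb x))) (Ra x) (Rb x)).
  rewrite (Q a phi Ha), (Q b psi Hb), H in PM.
  unfold is_pseries in PM. revert PM; apply is_series_ext. intros m.
  rewrite pow_n_pow. reflexivity.
Qed.

(** * Polynomials as finite power series *)

Lemma coord_sum_n i (T : nat -> quat) n : coord i (sum_n T n) = sum_n (fun k => coord i (T k)) n.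
Proof.
induction n as [|n IH]; [now rewrite 2!sum_O|].
rewrite 2!sum_Sn. etransitivity; [apply coord_plus|]. now rewrite IH.
Qed.

Lemma qis_series_finite (T : nat -> quat) M : (forall n, (M < n)%nat -> T n = zero) ->
  qis_series T (sum_n T M).
Proof.
intros H i. rewrite coord_sum_n.
match goal with |- is_series ?a ?l => change (is_lim_seq (sum_n a) (Finite l)) end.
apply (is_lim_seq_ext_loc (fun _ => sum_n (fun n => coord i (T n)) M)); [|apply is_lim_seq_const].
exists M. intros n Hn. induction Hn as [|n Hn IH]; [reflexivity|].
rewrite sum_Sn, <- IH, H by lia. rewrite coord_zero. symmetry. apply Rplus_0_r.
Qed.

Lemma entire_finite (b : nat -> quat) M : (forall n, (M < n)%nat -> b n = zero) -> entire b.
Proof.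
intros H r _.
apply (ex_series_incr_n (V := R_NormedModule) _ (S M)).
apply ex_series_ext with (fun _ : nat => 0).
- intros n. rewrite H by lia. rewrite qnorm_zero. symmetry; apply Rmult_0_r.
- exists 0. apply (is_series_first (fun _ => 0)). reflexivity.
Qed.

Lemma power_series_finite b M q : (forall n, (M < n)%nat -> b n = zero) ->
  power_series b q = sum_n (fun n => mult (pow_n q n) (b n)) M.
Proof.
intros H. apply qis_series_unique.
apply (qis_series_finite (fun n => monomial (b n) n q) M).
intros n Hn. unfold monomial. rewrite H by exact Hn. apply qmult_0_r.
Qed.

Lemma power_series_zero b q : (forall n, b n = zero) -> power_series b q = zero.
Proof.
intros H. rewrite (power_series_finite b 0) by auto. rewrite sum_O, H. apply qmult_0_r.
Qed.

(** * Twisted power series on a slice *)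

Lemma qis_series_twist K T l : qis_series T l -> qis_series (fun n => twist K (T n)) (twist K l).
Proof.
intros H. unfold twist. apply qis_series_scal, qis_series_plus; [exact H|].
apply (qis_series_mult_r K (fun n => mult K (T n))). now apply qis_series_mult_l.
Qed.

Lemma monomial_slice K z a n : sphere K ->
  monomial a n (slice K z) = mult (slice K (z ^ n)%C) a.
Proof. intros HK. unfold monomial. now rewrite slice_pow. Qed.

(** Powers of a point of C_K commute with K, so [twist] passes over them to the coefficient. *)
Lemma twist_monomial_slice K z a n : sphere K ->
  twist K (monomial a n (slice K z)) = monomial (twist K a) n (slice K z).
Proof.
intros HK. rewrite 2!monomial_slice by exact HK.
assert (C : mult K (slice K (z ^ n)%C) = mult (slice K (z ^ n)%C) K) by
  (unfold slice; generalize (Re (z ^ n)%C) (Im (z ^ n)%C); intros; quat_ring).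
unfold twist. rewrite qmult_scal_r, qmult_plus_r, (qmult_assoc K), C, !qmult_assoc. reflexivity.
Qed.

Lemma monomial_real K x a n : sphere K -> monomial a n (slice K (RtoC x)) = scal (x ^ n) a.
Proof.
intros HK. rewrite monomial_slice, <- RtoC_pow, slice_real by exact HK.
generalize (x ^ n); intros. quat_ring.
Qed.

Lemma twist_power_series_integral K a c : sphere K -> entire a -> entire c ->
  (forall x : R, mult (twist K (power_series a (slice K (RtoC x)))) (power_series c (slice K (RtoC x))) = zero) ->
  (exists z, twist K (power_series a (slice K z)) <> zero) -> forall n, c n = zero.
Proof.
intros HK Ha Hc H [z Hz].
(* If [twist K] killed every coefficient, the twisted series would vanish on the whole slice; so one
   nonzero value, at a possibly nonreal point, yields a nonzero real coefficient. *)
assert (Z : exists m i, coord i (twist K (a m)) <> 0).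
{ apply Classical_Prop.NNPP; intros N. apply Hz.
  assert (Q := qis_series_twist K _ _ (qis_series_power_series a (slice K z) Ha)).
  apply coord_eq; intros i. rewrite <- (is_series_unique _ _ (Q i)), coord_zero.
  rewrite (Series_ext _ (fun _ => 0)).
  - apply is_series_unique, (is_series_first (fun _ => 0)). reflexivity.
  - intros n. rewrite twist_monomial_slice by exact HK.
    replace (twist K (a n)) with (zero : quat).
    + unfold monomial. rewrite qmult_0_r. apply coord_zero.
    + symmetry. apply coord_eq; intros j. rewrite coord_zero.
      apply Classical_Prop.NNPP; intros X. apply N. now exists n, j. }
destruct Z as (m & i & Hmi).
intros n. apply coord_eq; intros j. rewrite coord_zero.
apply (series_integral (fun n => coord i (twist K (a n))) (fun n => coord j (c n))
  (fun x => coord i (twist K (power_series a (slice K (RtoC x)))))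
  (fun x => coord j (power_series c (slice K (RtoC x))))) with (i := m); auto.
- intros x. assert (Q := qis_series_twist K _ _ (qis_series_power_series a (slice K (RtoC x)) Ha) i).
  eapply is_series_ext; [|exact Q]. intros k.
  cbv beta. rewrite twist_monomial_slice, monomial_real by exact HK. apply coord_scal.
- intros x. assert (Q := qis_series_power_series c (slice K (RtoC x)) Hc j).
  eapply is_series_ext; [|exact Q]. intros k.
  cbv beta. rewrite monomial_real by exact HK. apply coord_scal.
(* Which factor vanishes may depend on x; the product of the two coordinates is zero in either
   case. *)
- intros x. destruct (qmult_integral _ _ (H x)) as [E|E]; rewrite E, coord_zero; ring.
Qed.

Theorem theorem3p4 (f g : quat -> quat) (hf : slice_regular f) (hg : slice_regular g)
    (I J : quat) (hI : sphere I) (hJ : sphere J) (hIJ : perp I J)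
    (F G : C -> C) (hF : holomorphic F) (hG : holomorphic G)
    (hsplit : forall z : C,
        f (slice I z) = plus (slice I (F z)) (mult (slice I (G z)) J))
    (hG0 : exists z : C, G z <> RtoC 0) :
  S_polyregular (dot_product f g) <-> right_polynomial g.
Proof.
assert (Ef := slice_regular_power_series f hf). assert (Eg := slice_regular_power_series g hg).
assert (Ha := slice_regular_entire f hf). assert (Hb := slice_regular_entire g hg).
set (a := taylor_coef f) in *. set (b := taylor_coef g) in *.
split.
- intros [n [_ Hn]].
  (* Level n means n + 1 applications of [dbar], hence the derivative of order n + 1 of g vanishes
     and n bounds the degree. *)
  assert (Z : forall m, Nat.iter (S n) dcoef b m = zero).
  { apply (twist_power_series_integral I a); auto.
    - now apply iter_dcoef_entire.
    - intros x. assert (H := Hn I hI x 0).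
      assert (E : restr (dot_product f g) I = (fun x y => mult (restr (power_series a) I x y) (restr (power_series b) I x y))).
      { unfold restr, dot_product. now rewrite <- Ef, <- Eg. }
      rewrite E, iter_dbar_mult in H by assumption. exact H.
    - destruct hG0 as [z Hz]. exists z. rewrite <- Ef, hsplit, twist_split by assumption.
      intros E. destruct (qmult_integral _ _ E) as [E'|E'].
      + apply Hz. now apply (slice_eq_zero I).
      + assert (E1 : mult J J = zero) by (rewrite E'; apply qmult_0_l).
        unfold sphere in hJ. rewrite hJ in E1. apply (f_equal (coord 0)) in E1.
        change (- 1 = 0) in E1. lra. }
  exists n, b. intros q. transitivity (power_series b q); [now rewrite <- Eg|]. apply power_series_finite.
  (* For m > n, coefficient m of g is up to a nonzero factor coefficient m - (n + 1) of its
     derivative of order n + 1. *)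
  intros m Hm. destruct (iter_dcoef b (S n) (m - S n)) as (c & Hc & E).
  rewrite Z in E. replace (S n + (m - S n))%nat with m in E by lia.
  now apply (scal_eq_zero c).
- intros (M & beta & Hbeta).
  (* The values of [beta] past M are arbitrary; cutting them off makes g the sum of an entire
     series. *)
  set (b' := fun n => if (n <=? M)%nat then beta n else (zero : quat)).
  assert (Hz : forall n, (M < n)%nat -> b' n = zero).
  { intros n Hn. unfold b'. destruct (Nat.leb_spec n M); [lia|reflexivity]. }
  assert (Hb' := entire_finite b' M Hz).
  assert (Eg' : g = power_series b').
  { apply functional_extensionality; intros q. rewrite Hbeta, (power_series_finite b' M q Hz).
    apply sum_n_ext_loc. intros n Hn. unfold b'. destruct (Nat.leb_spec n M); [reflexivity|lia]. }
  (* A polynomial of degree at most M has zero derivative of order M + 1, and [SR M] applies [dbar]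
     exactly M + 1 times. *)
  exists M; split.
  + apply smooth_mult; [rewrite Ef|rewrite Eg]; now apply power_series_smooth.
  + intros K HK x y.
    assert (E : restr (dot_product f g) K = (fun x y => mult (restr (power_series a) K x y) (restr (power_series b') K x y))).
    { unfold restr, dot_product. now rewrite <- Ef, <- Eg'. }
    rewrite E, iter_dbar_mult by assumption.
    unfold restr at 2. rewrite power_series_zero; [apply qmult_0_r|].
    intros n. destruct (iter_dcoef b' (S M) n) as (c & _ & ->).
    rewrite Hz by lia. apply qscal_0_r.
Qed.
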